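(* Let $X\subset\mathbb{R}^n$ be a compact subset of positive reach. Assume that $S\subset\mathbb{R}^n$ is a sample approximating $X$, let $0<\alpha<\alpha'$, and for each $k$ let $$\widetilde H_k=\operatorname{im}\Big(H_k(\check{C}(S,\alpha))\to H_k(\check{C}(S,\alpha'))\Big)$$ be the image of the map induced by the inclusion. If $$d_H(X,S)<\min\{\alpha,(\alpha'-\alpha)/2\}\quad\text{and}\quad \mathrm{Rch}(X)>\max\{4\,d_H(X,S),\ \alpha'+d_H(X,S)\},$$ then $H_k(X)\cong\widetilde H_k$ for every $k$.
   Context: $\mathbb{R}^n$ carries the Euclidean metric $d$ and $B(x,r)=\{y: d(x,y)<r\}$. For a closed subset $X\subseteq\mathbb{R}^n$, the medial axis $ax(X)$ is the set of points of $\mathbb{R}^n$ that do not have a unique closest point on $X$, and the reach is $\mathrm{Rch}(X)=\inf_{y\in ax(X)}\min_{x\in X}d(x,y)$. For non-empty closed bounded sets $A,B$, the Hausdorff distance is $d_H(A,B)=\max\{\sup_{a\in A} d(a,B),\sup_{b\in B} d(b,A)\}$ with $d(a,B)=\inf_{b\in B}d(a,b)$; in particular $S$ is such a set. For $S\subseteq\mathbb{R}^n$ and $r>0$, the open Čech complex $\check{C}(S,r)$ is the simplicial complex with vertex set $S$ whose simplices are the finite non-empty $\sigma\subseteq S$ with $\bigcap_{x\in\sigma}B(x,r)\neq\emptyset$; for $r_1\le r_2$ there is an inclusion $\check{C}(S,r_1)\hookrightarrow\check{C}(S,r_2)$. Homology is taken with coefficients in a fixed field. *)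

(* Defs.v *)
From HB Require Import structures.
(* [freeg] comes first because it shadows [fintype.lift]. *)
From mathcomp Require Import freeg.
From mathcomp Require Import all_boot all_order all_algebra finmap.
From mathcomp Require Import all_classical reals ereal topology normedtype.

Set Implicit Arguments.
Unset Strict Implicit.
Unset Printing Implicit Defensive.

Import Order.TTheory GRing.Theory Num.Theory.
Import numFieldNormedType.Exports.

Local Open Scope classical_set_scope.
Local Open Scope ring_scope.
Local Open Scope quotient_scope.

Section KernelImage.
Variables (K : fieldType) (U V : lmodType K) (f : {linear U -> V}).

Definition ker_pred : {pred U} := [pred u | f u == 0].

Lemma ker_pred_closed : submod_closed ker_pred.
Proof.
split=> [|a u v]; rewrite !inE ?linear0// => /eqP fu /eqP fv.
by rewrite linearP fu fv scaler0 addr0.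
Qed.

HB.instance Definition _ := GRing.isSubmodClosed.Build K U ker_pred
  (GRing.submod_closed_semi ker_pred_closed).

Record lin_ker := LinKer { ker_val : U; ker_valP : ker_val \in ker_pred }.
HB.instance Definition _ := [isSub for ker_val].
HB.instance Definition _ := [Choice of lin_ker by <:].
HB.instance Definition _ := [SubChoice_isSubLmodule of lin_ker by <:].

Definition im_pred : {pred V} := [pred v | `[< exists u, f u = v >]].

Lemma im_pred_closed : submod_closed im_pred.
Proof.
split=> [|a _ _ /asboolP[x <-] /asboolP[y <-]]; apply/asboolP.
  by exists 0; rewrite linear0.
by exists (a *: x + y); rewrite linearP.
Qed.

HB.instance Definition _ := GRing.isSubmodClosed.Build K V im_pred
  (GRing.submod_closed_semi im_pred_closed).

Lemma im_pred_oppr : oppr_closed im_pred.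
Proof. by move=> v vW; rewrite -scaleN1r rpredZ. Qed.
HB.instance Definition _ := GRing.isOppClosed.Build V im_pred im_pred_oppr.

Record lin_im := LinIm { im_val : V; im_valP : im_val \in im_pred }.
HB.instance Definition _ := [isSub for im_val].
HB.instance Definition _ := [Choice of lin_im by <:].
HB.instance Definition _ := [SubChoice_isSubLmodule of lin_im by <:].

End KernelImage.

Section Cokernel.
Variables (K : fieldType) (U V : lmodType K) (f : {linear U -> V}).

Definition coker := Quotient.quot (im_pred f).
HB.instance Definition _ := ZmodQuotient.on coker.

Definition coker_scale (a : K) : coker -> coker := lift_op1 coker ( *:%R a).

Lemma pi_coker_scale a : {morph \pi_coker : x / a *: x >-> coker_scale a x}.
Proof.
move=> x; unlock coker_scale; apply/eqP; rewrite piE /Quotient.equiv.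
rewrite -scalerBr; apply: rpredZ.
by rewrite Quotient.idealrBE reprK.
Qed.
Canonical pi_coker_scale_morph a := PiMorph1 (pi_coker_scale a).

Lemma coker_scaleA a b v : coker_scale a (coker_scale b v) = coker_scale (a * b) v.
Proof. by rewrite -[v]reprK !piE scalerA. Qed.
Lemma coker_scale1 : left_id 1 coker_scale.
Proof. by move=> v; rewrite -[v]reprK !piE scale1r. Qed.
Lemma coker_scaleDr : right_distributive coker_scale +%R.
Proof. by move=> a u v; rewrite -[u]reprK -[v]reprK !piE scalerDr. Qed.
Lemma coker_scaleDl v : {morph coker_scale^~ v : a b / a + b}.
Proof. by move=> a b; rewrite -[v]reprK !piE scalerDl. Qed.

HB.instance Definition _ := GRing.Zmodule_isLmodule.Build K coker
  coker_scaleA coker_scale1 coker_scaleDr coker_scaleDl.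

Definition coker_pi (v : V) : coker := \pi v.

Lemma coker_pi_linear : linear coker_pi.
Proof. by move=> a u v; rewrite /coker_pi !piE. Qed.

HB.instance Definition _ := GRing.isLinear.Build K V coker *:%R coker_pi
  coker_pi_linear.

Lemma coker_piK h : coker_pi (repr h) = h.
Proof. exact: reprK. Qed.

Lemma coker_pi_eq u v : coker_pi u = coker_pi v <-> exists w, f w = u - v.
Proof.
split=> [/eqP|[w fw]]; last apply/eqP; rewrite /coker_pi -Quotient.idealrBE.
  by move=> /asboolP.
by apply/asboolP; exists w.
Qed.

End Cokernel.

Definition lmod_iso (K : fieldType) (U V : lmodType K) : Prop :=
  exists f : {linear U -> V}, bijective f.


Section ChainComplexes.
Variable K : fieldType.

(* There is no module in degree -1: [0.-1] is [0], and [bdry 0] is required to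
   vanish, so that every 0-chain is a cycle (the homology is not reduced). *)
Record chain_complex := ChainComplex {
  chain :> nat -> lmodType K;
  bdry : forall k, {linear chain k -> chain k.-1};
  bdry0 : forall c, bdry 0 c = 0;
  bdryK : forall k c, bdry k (bdry k.+1 c) = 0
}.

Record chain_map (C D : chain_complex) := ChainMap {
  chain_fun :> forall k, {linear C k -> D k};
  chain_funP : forall k c, chain_fun k.-1 (bdry C k c) = bdry D k (chain_fun k c)
}.

Section Homology.
Variables (C : chain_complex) (k : nat).

Lemma bdry_cycle_subproof (c : C k.+1) :
  (bdry C k.+1 c : C k) \in ker_pred (bdry C k).
Proof. by rewrite inE bdryK. Qed.

Definition bdry_cycle (c : C k.+1) : lin_ker (bdry C k) :=
  LinKer (bdry_cycle_subproof c).

Lemma bdry_cycle_linear : linear bdry_cycle.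
Proof. by move=> a c c'; apply/val_inj; rewrite /= linearP. Qed.

HB.instance Definition _ := GRing.isLinear.Build K (C k.+1) (lin_ker (bdry C k))
  *:%R bdry_cycle bdry_cycle_linear.

Definition homology : lmodType K := coker bdry_cycle.

End Homology.

Section HomologyMap.
Variables (C D : chain_complex) (f : chain_map C D) (k : nat).

Lemma cycle_map_subproof (z : lin_ker (bdry C k)) :
  f k (val z) \in ker_pred (bdry D k).
Proof.
by case: z => z /=; rewrite !inE -chain_funP => /eqP ->; rewrite linear0.
Qed.

Definition cycle_map (z : lin_ker (bdry C k)) : lin_ker (bdry D k) :=
  LinKer (cycle_map_subproof z).

Lemma cycle_map_linear : linear cycle_map.
Proof. by move=> a z z'; apply/val_inj; rewrite /= linearP. Qed.

HB.instance Definition _ := GRing.isLinear.Build K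
  (lin_ker (bdry C k)) (lin_ker (bdry D k)) *:%R cycle_map cycle_map_linear.

Definition homology_map (h : homology C k) : homology D k :=
  coker_pi (@bdry_cycle D k) (cycle_map (repr h)).

Lemma homology_map_pi (z : lin_ker (bdry C k)) :
  homology_map (coker_pi (@bdry_cycle C k) z) =
  coker_pi (@bdry_cycle D k) (cycle_map z).
Proof.
have /coker_pi_eq[c bc] := coker_piK (coker_pi (@bdry_cycle C k) z).
apply/coker_pi_eq; exists (f k.+1 c); rewrite -linearB -bc.
by apply/val_inj; rewrite /= -chain_funP.
Qed.

Lemma homology_map_linear : linear homology_map.
Proof.
move=> a g h; rewrite -[g]coker_piK -[h]coker_piK.
by rewrite -linearP !homology_map_pi !linearP.
Qed.

HB.instance Definition _ := GRing.isLinear.Build K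
  (homology C k) (homology D k) *:%R homology_map homology_map_linear.

End HomologyMap.
End ChainComplexes.

(* A semi-simplicial set (a simplicial set without degeneracies). *)
Record semisimplicial := SemiSimplicial {
  cell :> nat -> choiceType;
  face : forall k, 'I_k.+2 -> cell k.+1 -> cell k;
  faceK : forall k (i j : 'I_k.+2) (x : cell k.+2), (i <= j)%N ->
    face i (face (lift ord0 j) x) = face j (face (widen_ord (leqnSn _) i) x)
}.

Record semisimplicial_map (A B : semisimplicial) := SemiSimplicialMap {
  cell_fun :> forall k, A k -> B k;
  cell_funP : forall k (i : 'I_k.+2) (x : A k.+1),
    cell_fun (face i x) = face i (cell_fun x)
}.

Section FreeModule.
Variables (K : fieldType) (T : choiceType) (M : lmodType K) (g : T -> M).

Lemma fglift_linear : linear (fglift g : {freeg T / K} -> M).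
Proof.
have fgB := @lift_is_additive K T M g.
have fg0 : fglift g 0 = 0 by rewrite -(subr0 0) fgB subrr.
have fgD x y : fglift g (x + y) = fglift g x + fglift g y.
  by rewrite -{1}(opprK y) fgB -(sub0r y) fgB fg0 sub0r opprK.
have fgsum (s : seq T) (c : T -> K) :
    fglift g (\sum_(x <- s) << c x *g x >>) = \sum_(x <- s) c x *: g x.
  by elim/big_rec2: _ => // x _ y _ <-; rewrite fgD liftU.
move=> a x y; rewrite fgD; congr (_ + _).
have -> : a *: x = \sum_(t <- dom x) << a * coeff t x *g t >> by [].
rewrite fgsum -[in RHS](freeg_sumE x) fgsum scaler_sumr.
by apply: eq_bigr => t _; rewrite scalerA.
Qed.

HB.instance Definition _ :=
  GRing.isLinear.Build K {freeg T / K} M *:%R (fglift g) fglift_linear.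

Lemma fglift1 x : fglift g << x >> = g x.
Proof. by rewrite liftU scale1r. Qed.

End FreeModule.

Lemma eq_freeg_linear (K : fieldType) (T : choiceType) (M : lmodType K)
    (f g : {linear {freeg T / K} -> M}) :
  (forall x, f << x >> = g << x >>) -> f =1 g.
Proof.
move=> fg c; rewrite -[c]freeg_sumE !linear_sum; apply: eq_bigr => x _.
suff -> : << coeff x c *g x >> = coeff x c *: (<< x >> : {freeg T / K}).
  by rewrite !linearZ /= fg.
by apply/eqP/freeg_eqP => y; rewrite coeffZ !coeffU mul1r.
Qed.

Section Chains.
Variable K : fieldType.

Section Chain.
Variable A : semisimplicial.

Definition cell_bdry k (x : A k.+1) : {freeg (A k) / K} :=
  \sum_(i < k.+2) (-1) ^+ i *: << face i x >>.

Definition free_bdry k : {freeg (A k) / K} -> {freeg (A k.-1) / K} :=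
  if k is k'.+1 then fglift (@cell_bdry k') else fun=> 0.

Lemma free_bdry_linear k : linear (@free_bdry k).
Proof. by case: k => [|k] a x y; rewrite /= ?scaler0 ?addr0// linearP. Qed.

HB.instance Definition _ k := GRing.isLinear.Build K
  {freeg (A k) / K} {freeg (A k.-1) / K} *:%R (@free_bdry k) (@free_bdry_linear k).

Lemma free_bdryK k c : @free_bdry k (@free_bdry k.+1 c) = 0.
Proof.
case: k c => [//|k] c.
apply: (eq_freeg_linear (f := @free_bdry k.+1 \o @free_bdry k.+2) (g := \0)) => x /=.
rewrite fglift1 /cell_bdry linear_sum /=.
under eq_bigr do rewrite linearZ /= fglift1 /cell_bdry scaler_sumr.
rewrite pair_big /=.
under eq_bigr do rewrite scalerA.
pose P (p : 'I_k.+3 * 'I_k.+2) := (p.1 <= p.2)%N.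
rewrite (bigID P) /= addrC.
pose h (p : 'I_k.+3 * 'I_k.+2) : 'I_k.+3 * 'I_k.+2 :=
  (lift ord0 p.2, inord p.1).
pose h' (p : 'I_k.+3 * 'I_k.+2) : 'I_k.+3 * 'I_k.+2 :=
  (widen_ord (leqnSn _) p.2, inord p.1.-1).
rewrite (reindex_onto h h') /=; last first.
  move=> [j i]; rewrite /P /h /h' /= -ltnNge => ij.
  have j0 : (0 < j)%N by apply: leq_ltn_trans ij.
  congr pair; apply/val_inj; rewrite /= ?inordK //.
  - by rewrite /bump /= add1n prednK.
  - by rewrite -ltnS prednK.
rewrite (eq_bigl P); last first.
  move=> [i j]; rewrite /P /h /h' /= -ltnNge /bump /= add1n.
  case: (ltnP i k.+2) => ik.
    rewrite inordK // ltnS; case: leqP => //= ij.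
    apply/eqP; congr pair; apply/val_inj; rewrite /= inordK //.
    by rewrite add0n ltn_ord.
  have ij : (i <= j)%N = false.
    by apply/negbTE; rewrite -ltnNge (leq_trans (ltn_ord j)).
  rewrite ij; apply/negbTE/negP => /andP[_ /eqP[/(congr1 val)/= e _]].
  by move: ik; rewrite -e leqNgt ltn_ord.
rewrite -big_split big1 //= => -[i j]; rewrite /P /h /= => ij.
have ik : (i < k.+2)%N by rewrite (leq_ltn_trans ij).
rewrite /bump /= add1n inordK //.
have -> : face (inord i) (face (lift ord0 j) x) = face j (face i x).
  rewrite faceK ?inordK //; congr (face j (face _ x)).
  by apply/val_inj; rewrite /= inordK.
by rewrite exprS mulN1r -scalerDl mulNr [X in - X]mulrC addNr scale0r.
Qed.

Definition free_complex : chain_complex K :=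
  @ChainComplex K (fun k => {freeg (A k) / K}) free_bdry
    (fun=> erefl) free_bdryK.

End Chain.

Section Map.
Variables (A B : semisimplicial) (f : semisimplicial_map A B).

Definition free_fun k : {freeg (A k) / K} -> {freeg (B k) / K} :=
  fglift (fun x => << f k x >>).
HB.instance Definition _ k := GRing.isLinear.Build K
  {freeg (A k) / K} {freeg (B k) / K} *:%R (@free_fun k) (fglift_linear _).

Lemma free_funP k c :
  @free_fun k.-1 (@free_bdry A k c) = @free_bdry B k (@free_fun k c).
Proof.
case: k c => [|k] c; first by rewrite /= linear0.
apply: (eq_freeg_linear (f := @free_fun k \o @free_bdry A k.+1)
  (g := @free_bdry B k.+1 \o @free_fun k.+1)) => x /=.
rewrite /free_fun !fglift1 /cell_bdry linear_sum.
apply: eq_bigr => i _.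
by rewrite linearZ /= fglift1 cell_funP.
Qed.

Definition free_map : chain_map (free_complex A) (free_complex B) :=
  @ChainMap K (free_complex A) (free_complex B) free_fun free_funP.

End Map.
End Chains.

Section SingularHomology.
Variables (R : realType) (T : topologicalType).

Definition std_simplex k : set 'rV[R]_k.+1 :=
  [set t | (forall i, 0 <= t 0 i) /\ \sum_i t 0 i = 1].
Arguments std_simplex : clear implicits.

Definition coface_mx k (h : 'I_k.+2) (t : 'rV[R]_k.+1) : 'rV[R]_k.+2 :=
  \row_m oapp (t 0) 0 (unlift h m).

Lemma coface_subproof k (h : 'I_k.+2) (t : std_simplex k) :
  coface_mx h (val t) \in std_simplex k.+1.
Proof.
case: t => t /= /set_mem[t0 t1]; apply/mem_set; split=> [m|].
  by rewrite mxE; case: unlift => [l|] /=.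
rewrite (bigD1_ord h)//= mxE unlift_none add0r -t1.
by apply: eq_bigr => l _; rewrite mxE liftK.
Qed.

Definition coface k (h : 'I_k.+2) (t : std_simplex k) : std_simplex k.+1 :=
  exist _ (coface_mx h (val t)) (coface_subproof h t).

Lemma coface_continuous k (h : 'I_k.+2) : continuous (coface h).
Proof.
apply: (@continuous_comp_initial _ _ _ set_val) => t /= A [P nP sPA].
apply: (@filterS _ _ _ [set u : std_simplex k |
  forall m, P 0 m (coface_mx h (val u) 0 m)]).
  by move=> u Pu; apply: sPA => i m; rewrite ord1.
apply: (@filter_forall _ 'I_k.+2
  (fun m (u : std_simplex k) => P 0 m (coface_mx h (val u) 0 m))
  (nbhs t) (nbhs_filter t)) => m.
have : {for t, continuous (fun u : std_simplex k => coface_mx h (val u) 0 m)}.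
  have -> : (fun u : std_simplex k => coface_mx h (val u) 0 m) =
      (fun u => oapp (val u 0) 0 (unlift h m)).
    by apply/funext => u; rewrite mxE.
  case: unlift => [l|] /=; last exact: cst_continuous.
  apply: (@continuous_comp _ _ _ set_val (fun v : 'rV[R]_k.+1 => v 0 l)).
    exact: initial_continuous.
  exact: coord_continuous.
by apply; exact: nP.
Qed.

HB.instance Definition _ k h := @isContinuous.Build _ _ (@coface k h)
  (@coface_continuous k h).

Lemma bump_bump i j l : (i <= j)%N -> bump j.+1 (bump i l) = bump i (bump j l).
Proof.
move=> ij; rewrite /bump; case: (leqP j l) => jl /=.
  by rewrite (leq_trans ij jl) !add1n ltnS jl (leq_trans ij (leqW jl)).
rewrite add0n; case: (leqP i l) => il; rewrite ?add1n ?add0n ?ltnS.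
  by rewrite leqNgt jl.
by rewrite ltnNge (ltnW jl).
Qed.

Lemma lift_lift k (i j : 'I_k.+2) (l : 'I_k.+1) : (i <= j)%N ->
  lift (lift ord0 j) (lift i l) = lift (widen_ord (leqnSn _) i) (lift j l).
Proof. by move=> ij; apply/val_inj; rewrite /= [bump 0 j]add1n bump_bump. Qed.

Lemma coface_coface k (i j : 'I_k.+2) (t : std_simplex k) : (i <= j)%N ->
  coface (lift ord0 j) (coface i t) =
  coface (widen_ord (leqnSn _) i) (coface j t).
Proof.
move=> ij; apply/val_inj/rowP => m; rewrite !mxE /=.
have [l ->|->] := unliftP (lift ord0 j) m; rewrite /= ?mxE.
  have [l' ->|->] := unliftP i l; first by rewrite lift_lift// liftK /= mxE liftK.
  have -> : lift (lift ord0 j) i = widen_ord (leqnSn _) i.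
    by apply/val_inj; rewrite /= [bump 0 j]add1n /bump ltnNge ij.
  by rewrite unlift_none.
have -> : lift ord0 j = lift (widen_ord (leqnSn _) i) j.
  by apply/val_inj; rewrite /= /bump /= ij.
by rewrite liftK /= mxE unlift_none.
Qed.

Definition singular_simplex k : choiceType :=
  continuousType (std_simplex k) T.

Definition singular_face k (h : 'I_k.+2) (s : singular_simplex k.+1) :
  singular_simplex k := (s : continuousType _ _) \o coface h.

Lemma singular_faceK k (i j : 'I_k.+2) (s : singular_simplex k.+2) :
  (i <= j)%N -> singular_face i (singular_face (lift ord0 j) s) =
  singular_face j (singular_face (widen_ord (leqnSn _) i) s).
Proof.
by move=> ij; apply/continuousEP => t; rewrite /= coface_coface.
Qed.

Definition singular_set : semisimplicial := SemiSimplicial singular_faceK.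

Definition singular_homology (K : fieldType) (k : nat) : lmodType K :=
  homology (free_complex K singular_set) k.

End SingularHomology.

Record simplicial_complex (V : choiceType) := SimplicialComplex {
  simplex_set :> set {fset V};
  simplex_neq0 : forall s, simplex_set s -> s != fset0;
  simplex_sub : forall s t, simplex_set s ->
    (t `<=` s)%fset -> t != fset0 -> simplex_set t
}.

(* Simplicial chains are generated by the simplices with their vertices listed
   increasingly for a fixed total order on the ambient type of vertices. *)
Section SimplicialHomology.
Context {d : Order.disp_t} {V : orderType d}.

Section OrderedSimplices.
Variable C : simplicial_complex V.

Definition ordered_simplex_pred k : pred {ffun 'I_k.+1 -> V} := fun s =>
  [forall i : 'I_k.+1, forall j : 'I_k.+1, (i < j)%N ==> (s i < s j)%O] &&
  `[< simplex_set C [fset s i | i in 'I_k.+1]%fset >].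

Definition ordered_simplex k : choiceType :=
  {s : {ffun 'I_k.+1 -> V} | ordered_simplex_pred s}.

Lemma simplex_face_subproof k (h : 'I_k.+2) (s : ordered_simplex k.+1) :
  ordered_simplex_pred [ffun l : 'I_k.+1 => val s (lift h l)].
Proof.
case: s => s /= /andP[/forallP incr /asboolP Cs]; apply/andP; split.
  apply/forallP => i; apply/forallP => j; apply/implyP => ij.
  rewrite !ffunE; apply: (implyP (forallP (incr _) _)).
  by rewrite /= /bump; case: (leqP h i) => hi; rewrite ?add1n ?add0n;
    [rewrite (leq_trans hi (ltnW ij)) | rewrite (leq_trans ij)// leq_addl].
apply/asboolP; apply: simplex_sub Cs _ _.
  apply/fsubsetP => _ /imfsetP[l /= _ ->]; rewrite ffunE.
  exact: in_imfset.
apply/fset0Pn; exists (s (lift h ord0)); apply/imfsetP; exists ord0 => //.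
by rewrite ffunE.
Qed.

Definition simplex_face k (h : 'I_k.+2) (s : ordered_simplex k.+1) :
  ordered_simplex k :=
  exist (fun s => ordered_simplex_pred s) _ (simplex_face_subproof h s).

Lemma simplex_faceK k (i j : 'I_k.+2) (s : ordered_simplex k.+2) :
  (i <= j)%N -> simplex_face i (simplex_face (lift ord0 j) s) =
  simplex_face j (simplex_face (widen_ord (leqnSn _) i) s).
Proof.
by move=> ij; apply/val_inj/ffunP => l; rewrite !ffunE lift_lift.
Qed.

Definition ordered_set : semisimplicial := SemiSimplicial simplex_faceK.

Definition simplicial_homology (K : fieldType) (k : nat) : lmodType K :=
  homology (free_complex K ordered_set) k.

End OrderedSimplices.

Section Inclusion.
Variables (C D : simplicial_complex V) (CD : C `<=` D).

Lemma incl_subproof k (s : ordered_simplex C k) :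
  ordered_simplex_pred D (val s).
Proof.
case: s => s /= /andP[incr /asboolP Cs].
by apply/andP; split => //; apply/asboolP/CD.
Qed.

Definition incl_fun k (s : ordered_set C k) : ordered_set D k :=
  exist (fun s => ordered_simplex_pred D s) _ (incl_subproof s).

Lemma incl_funP k (i : 'I_k.+2) (s : ordered_set C k.+1) :
  incl_fun (face i s) = face i (incl_fun s).
Proof. exact/val_inj. Qed.

Definition incl_homology (K : fieldType) (k : nat) :
    {linear simplicial_homology C K k -> simplicial_homology D K k} :=
  @homology_map K _ _ (free_map K (SemiSimplicialMap incl_funP)) k.

End Inclusion.
End SimplicialHomology.

Section EuclideanSpace.
Variables (R : realType) (n : nat).
Implicit Types (x y : 'rV[R]_n) (r : R) (A B X S : set 'rV[R]_n).

Definition eucl_dist x y : R := Num.sqrt (\sum_i (x 0 i - y 0 i) ^+ 2).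

Definition eucl_ball x r : set 'rV[R]_n := [set y | eucl_dist x y < r].

Definition dist_to x A : R := inf [set eucl_dist x a | a in A].

Definition hausdorff_dist A B : R :=
  Num.max (sup [set dist_to a B | a in A]) (sup [set dist_to b A | b in B]).

Definition medial_axis X : set 'rV[R]_n :=
  [set y | ~ exists! x, X x /\ forall z, X z -> eucl_dist y x <= eucl_dist y z].

(* The reach is +oo when the medial axis is empty; [dist_to y X] is a minimum
   when X is closed and nonempty. *)
Definition reach X : \bar R :=
  ereal_inf [set (dist_to y X)%:E | y in medial_axis X].

(* An alias of 'rV[R]_n, totally ordered lexicographically; the order is only
   used to list the vertices of simplices. *)
Definition lexi_rV : Type := 'rV[R]_n.
HB.instance Definition _ := Choice.on lexi_rV.

Definition lexi_tuple (x : lexi_rV) : n.-tuplelexi R :=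
  [tuple (x : 'rV[R]_n) 0 i | i < n].
Definition lexi_le (x y : lexi_rV) : bool := (lexi_tuple x <= lexi_tuple y)%O.

Lemma lexi_le_refl : reflexive lexi_le.
Proof. by move=> x; exact: lexx. Qed.
Lemma lexi_le_anti : antisymmetric lexi_le.
Proof.
move=> x y /le_anti xy; apply/rowP => i.
by have := congr1 (fun t : n.-tuple R => tnth t i) xy; rewrite !tnth_mktuple.
Qed.
Lemma lexi_le_trans : transitive lexi_le.
Proof. by move=> y x z; exact: le_trans. Qed.
Lemma lexi_le_total : total lexi_le.
Proof. by move=> x y; exact: le_total. Qed.

HB.instance Definition _ := Order.Le_isPOrder.Build (Order.Disp tt tt) lexi_rV
  lexi_le_refl lexi_le_anti lexi_le_trans.
HB.instance Definition _ := Order.POrder_isTotal.Build (Order.Disp tt tt) lexi_rV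
  lexi_le_total.

Definition cech_set S r : set {fset lexi_rV} :=
  [set s | [/\ s != fset0, [set` s] `<=` S &
    \bigcap_(x in [set` s]) eucl_ball x r !=set0]].

Lemma cech_set_neq0 S r s : cech_set S r s -> s != fset0.
Proof. by case. Qed.

Lemma cech_set_sub S r s t : cech_set S r s -> (t `<=` s)%fset -> t != fset0 ->
  cech_set S r t.
Proof.
move=> [_ sS [y sy]] /fsubsetP ts t0; split=> // [x /ts /sS //|].
by exists y => x /ts; exact: sy.
Qed.

Definition cech S r : simplicial_complex lexi_rV :=
  SimplicialComplex (@cech_set_neq0 S r) (@cech_set_sub S r).

Lemma cech_subset S r1 r2 : r1 <= r2 -> cech S r1 `<=` cech S r2.
Proof.
move=> r12 s [s0 sS [y sy]]; split => //.
by exists y => x xs; exact: lt_le_trans (sy x xs) r12.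
Qed.

End EuclideanSpace.

(* Main.v *)
From HB Require Import structures.
From mathcomp Require Import freeg.
Require Import Defs.
From mathcomp Require Import all_boot all_order all_algebra finmap.
From mathcomp Require Import all_classical reals ereal topology normedtype.
From mathcomp Require Import derive ring lra.

(* Write e for the Hausdorff distance.  Every point of the affine simplex on a
   simplex s of the Cech complex C(S, alpha') is within alpha' of a vertex of s,
   hence at distance less than the reach from X, so composing with the nearest
   point projection gives a chain map Phi from C(S, alpha') to the singular
   chains of X.  Restricted to the image of the homology of C(S, alpha), the map
   induced by Phi is bijective.
   - Surjectivity: subdivide a singular cycle so finely that its simplices have
     diameter less than a small delta, and replace their vertices by points of S
     at distance at most e; the resulting simplices lie in C(S, alpha) since
     delta + e <= alpha.  Their image under Phi is homologous to the cycle, by a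
     straight-line homotopy followed by the projection.
   - Injectivity: the same recipe applied to Phi c gives a cycle that bounds in
     C(S, alpha) as soon as Phi c bounds in X.  This cycle is homologous in
     C(S, alpha') to the inclusion of c: both replace the vertices of a fine
     subdivision of the realization of c by points of S, the first one by a
     point within alpha + 2 e, the second one by a vertex of the simplex within
     alpha, and delta + alpha + 2 e <= alpha'.
   The subdivision is a universal chain of tuples of points of the standard
   simplices; it exists because the complex of tuples of diameter less than eta
   in a convex set is acyclic for every eta > 0. *)

Set Implicit Arguments.
Unset Strict Implicit.
Unset Printing Implicit Defensive.

Import Order.TTheory GRing.Theory Num.Theory.
Import numFieldNormedType.Exports.

Local Open Scope classical_set_scope.
Local Open Scope ring_scope.

(** * Chains supported on a subcomplex *)

(** Cech chains are generated by strictly increasing tuples, whereas replacing points by nearby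
    samples yields tuples with repetitions and in no particular order. The geometry is therefore
    done in complexes of arbitrary tuples, on which every map of sets acts, and acyclic carriers
    lead from there to ordered simplices. They provide chain maps and homotopies by mere choice, and
    neither the choice of a sample nor that of a vertex has to be continuous: only the finite set of
    points that a cell may use matters. The scale of the subdivision is fixed after the cycle. A
    chain has finitely many simplices, so one modulus of continuity serves them all; for injectivity
    one modulus serves [c] and the chain that bounds its image. The vertex attached to a point of a
    realization depends on the simplex in which the point is taken, so the two replacements cannot
    be compared on points alone; hence the tuples of pairs. In the bound alpha + 2 e, the step from
    the point to a vertex costs alpha, from the vertex to X costs e, and the nearest point of X is
    no farther; the last e leads from there to its sample. [delta] is the slack that remains. *)

Section Support.
Variable K : fieldType.
Implicit Types T U : choiceType.

Lemma fgliftE T (M : lmodType K) (g : T -> M) (c : {freeg T / K}) :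
  fglift g c = \sum_(x <- dom c) coeff x c *: g x.
Proof.
rewrite -{1}[c]freeg_sumE linear_sum; apply: eq_bigr => x _.
by rewrite /= liftU.
Qed.

(** Subcomplexes are predicates on chains rather than semi-simplicial sets of their own, so that
    maps stay total and the subcomplex may vary from cell to cell. *)
Definition supported T (P : set T) (c : {freeg T / K}) : Prop :=
  forall x, x \in dom c -> P x.

Lemma supported_dom T (c : {freeg T / K}) : supported [set` dom c] c.
Proof. by []. Qed.

Lemma supportedS T (P Q : set T) c : P `<=` Q -> supported P c -> supported Q c.
Proof. by move=> PQ cP x /cP /PQ. Qed.

Lemma supported0 T (P : set T) : supported P 0.
Proof. by move=> x; rewrite dom0. Qed.

Lemma supportedD T (P : set T) c e :
  supported P c -> supported P e -> supported P (c + e).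
Proof.
by move=> cP eP x /domD_subset; rewrite mem_cat => /orP[/cP|/eP].
Qed.

Lemma supportedN T (P : set T) c : supported P c -> supported P (- c).
Proof. by move=> cP x; rewrite domN => /cP. Qed.

Lemma supportedB T (P : set T) c e :
  supported P c -> supported P e -> supported P (c - e).
Proof. by move=> cP eP; apply: supportedD => //; exact: supportedN. Qed.

Lemma supportedZ T (P : set T) a c : supported P c -> supported P (a *: c).
Proof.
move=> cP x; rewrite mem_dom coeffZ => h; apply: cP; rewrite mem_dom.
by apply: contraNneq h => ->; rewrite mulr0.
Qed.

Lemma supported_sum T (P : set T) (I : eqType) (r : seq I) (Q : pred I) F :
  (forall i, i \in r -> Q i -> supported P (F i)) ->
  supported P (\sum_(i <- r | Q i) F i).
Proof.
move=> h; rewrite big_seq_cond; elim/big_ind: _ => [||i /andP[]].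
- exact: supported0.
- exact: supportedD.
- exact: h.
Qed.

Lemma supportedU T (P : set T) x : P x -> supported P << x >>.
Proof. by move=> Px y; rewrite domU1 inE => /eqP ->. Qed.

Lemma supported_lift T U (P : set T) (Q : set U) (f : T -> {freeg U / K}) c :
  supported P c -> (forall x, P x -> supported Q (f x)) ->
  supported Q (fglift f c).
Proof.
move=> cP h; rewrite fgliftE; apply: supported_sum => x xc _.
exact: supportedZ (h _ (cP _ xc)).
Qed.

(** The standard way below to prove an identity of chains: check it on generators, with [P := setT]
    when it holds for all cells and a smaller [P] when the maps behave well only there. *)
Lemma eq_supported T (M : lmodType K) (P : set T)
    (f g : {linear {freeg T / K} -> M}) c :
  supported P c -> (forall x, P x -> f << x >> = g << x >>) -> f c = g c.
Proof.
move=> cP fg; rewrite -[c]freeg_sumE !linear_sum; apply: eq_big_seq.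
move=> x /cP xP.
suff -> : << coeff x c *g x >> = coeff x c *: (<< x >> : {freeg T / K}).
  by rewrite !linearZ /= fg.
by apply/eqP/freeg_eqP => y; rewrite coeffZ !coeffU mul1r.
Qed.

(** The augmentation stands in for the missing boundary in degree 0, where [free_bdry] vanishes. *)
Definition aug T (c : {freeg T / K}) : K^o := fglift (fun=> 1) c.
HB.instance Definition _ T := GRing.isLinear.Build K {freeg T / K} K^o *:%R
  (@aug T) (fglift_linear _).

Lemma augU T (x : T) : aug << x >> = 1.
Proof. exact: fglift1. Qed.

End Support.

Section Subcomplexes.
Variable K : fieldType.
Implicit Types A B : semisimplicial.

Definition cells A := forall k, set (A k).

Definition face_closed A (P : cells A) :=
  forall k i (x : A k.+1), P k.+1 x -> P k (face i x).

Lemma free_bdryU A k (x : A k.+1) :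
  free_bdry << x >> = cell_bdry K x.
Proof. exact: fglift1. Qed.

Lemma supported_cell_bdry A (P : cells A) k (x : A k.+1) :
  face_closed P -> P k.+1 x -> supported (P k) (cell_bdry K x).
Proof.
move=> Pf Px; apply: supported_sum => i _ _; apply: supportedZ.
exact: supportedU (Pf _ _ _ Px).
Qed.

Lemma aug_cell_bdry A (x : A 1) : aug (cell_bdry K x) = 0.
Proof.
rewrite /cell_bdry !big_ord_recl big_ord0 addr0 expr0 scale1r expr1 scaleN1r.
by rewrite linearB /= !augU subrr.
Qed.

(** Vanishing of the reduced homology of [P], with fillings that stay in [P]; degree 0 is a clause
    of its own because its cycle condition is stated with [aug]. *)
Definition acyclic A (P : cells A) : Prop :=
  [/\ P 0 !=set0,
      forall c : {freeg (A 0) / K}, supported (P 0) c -> aug c = 0 ->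
        exists2 e : {freeg (A 1) / K}, supported (P 1) e & free_bdry e = c &
      forall k (c : {freeg (A k.+1) / K}), supported (P k.+1) c ->
        free_bdry c = 0 ->
        exists2 e : {freeg (A k.+2) / K},
          supported (P k.+2) e & free_bdry e = c].

(** [h] is a contracting homotopy onto [v]: extended linearly, it sends a cycle (of augmentation 0
    in degree 0) to a filling of it. *)
Lemma contractible_acyclic A (P : cells A) (v : A 0)
    (h : forall k, A k -> {freeg (A k.+1) / K}) :
  face_closed P -> P 0 v ->
  (forall k x, P k x -> supported (P k.+1) (h k x)) ->
  (forall x, P 0 x -> free_bdry (h 0 x) = << x >> - << v >>) ->
  (forall k x, P k.+1 x ->
     free_bdry (h k.+1 x) = << x >> - fglift (h k) (cell_bdry K x)) ->
  acyclic P.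
Proof.
move=> Pf Pv hP h0 hS; split; first by exists v.
- move=> c cP c0; exists (fglift (h 0) c);
  first exact: supported_lift cP (hP 0).
  transitivity (c - (aug c : K) *: << v >>); last by rewrite c0 scale0r subr0.
  transitivity (c - fglift (fun=> << v >>) c).
    apply: (@eq_supported K _ _ (P 0) (@free_bdry K A 1 \o fglift (h 0))
      (idfun \- fglift (fun=> << v >>))) => // x Px /=.
    by rewrite !fglift1; move: (h0 x Px) => /= ->.
  congr (_ - _); rewrite fgliftE -scaler_suml; congr (_ *: _).
  by rewrite /aug fgliftE; apply: eq_bigr => x _; rewrite /GRing.scale /= mulr1.
- move=> k c cP c0; exists (fglift (h k.+1) c).
    exact: supported_lift cP (hP _).
  transitivity (c - fglift (h k) (free_bdry c));
    last by rewrite c0 linear0 subr0.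
  apply: (@eq_supported K _ _ (P k.+1) (@free_bdry K A k.+2 \o fglift (h k.+1))
    (idfun \- (fglift (h k) \o @free_bdry K A k.+1))) => // x Px /=.
  by rewrite !fglift1; move: (hS k x Px) => /= ->.
Qed.

End Subcomplexes.

Lemma xget_and (T : choiceType) (x0 : T) (Q R : set T) :
  (exists2 x, Q x & R x) -> let x := xget x0 [set x | Q x /\ R x] in Q x /\ R x.
Proof. by move=> [x Qx Rx]; exact: (@xgetI _ x0 [set x | Q x /\ R x] x). Qed.

(** * Acyclic carriers *)

Section Carriers.
Variables (K : fieldType) (A B : semisimplicial) (A' : cells A).
Arguments A' : clear implicits.
Hypothesis A'_face : face_closed A'.
Implicit Types f g : forall k, A k -> {freeg (B k) / K}.

(* [f] is total, but it is a chain map only on the subcomplex [A']. *)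
Definition chain_on f := forall k a, A' k.+1 a ->
  free_bdry (f k.+1 a) = fglift (f k) (cell_bdry K a).

Definition aug_on f := forall a, A' 0 a -> aug (f 0 a) = 1.

Lemma free_bdry_cell k (a : A k.+2) : free_bdry (cell_bdry K a) = 0.
Proof. by rewrite -[cell_bdry K a]fglift1;
  exact: (@free_bdryK K A k.+1 << a >>). Qed.

(** Only one degree of the chain map property is assumed, so that this applies halfway through the
    inductive construction of [f]. *)
Lemma bdry_lift_subproof f k (c : {freeg (A k.+1) / K}) :
  (forall a, A' k.+1 a -> free_bdry (f k.+1 a) = fglift (f k) (cell_bdry K a))
    ->
  supported (A' k.+1) c ->
  free_bdry (fglift (f k.+1) c) = fglift (f k) (free_bdry c).
Proof.
move=> fP cA; apply: (@eq_supported K _ _ (A' k.+1)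
  (@free_bdry K B k.+1 \o fglift (f k.+1))
  (fglift (f k) \o @free_bdry K A k.+1)) => // a A'a /=.
by rewrite !fglift1; exact: fP.
Qed.

Lemma bdry_lift f k (c : {freeg (A k.+1) / K}) : chain_on f ->
  supported (A' k.+1) c ->
  free_bdry (fglift (f k.+1) c) = fglift (f k) (free_bdry c).
Proof. by move=> fP; apply: bdry_lift_subproof; exact: fP. Qed.

Lemma bdry_lift_cycle f k (c : {freeg (A k) / K}) : chain_on f ->
  supported (A' k) c -> free_bdry c = 0 -> free_bdry (fglift (f k) c) = 0.
Proof.
case: k c => // k c fP cA c0; rewrite bdry_lift//.
by rewrite [free_bdry c]c0 linear0.
Qed.

Lemma aug_lift f (c : {freeg (A 0) / K}) : aug_on f ->
  supported (A' 0) c -> aug (fglift (f 0) c) = aug c.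
Proof.
move=> fP cA; apply: (@eq_supported K _ _ (A' 0)
  (@aug K _ \o fglift (f 0)) (@aug K _)) => // a A'a /=.
by rewrite fglift1 augU fP.
Qed.

Variable P : forall k, A k -> cells B.
Arguments P : clear implicits.
Hypothesis P_acyclic : forall k a, A' k a -> acyclic K (P k a).
Hypothesis P_mono : forall k i (a : A k.+1), A' k.+1 a ->
  forall m, P k (face i a) m `<=` P k.+1 a m.

Definition carried f := forall k a, A' k a -> supported (P k a k) (f k a).

Lemma carried_bdry_subproof f k (a : A k.+1) :
  (forall b, A' k b -> supported (P k b k) (f k b)) -> A' k.+1 a ->
  supported (P k.+1 a k) (fglift (f k) (cell_bdry K a)).
Proof.
move=> fP A'a; rewrite linear_sum; apply: supported_sum => i _ _.
rewrite linearZ; apply: supportedZ => /=; rewrite fglift1.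
have fi := fP _ (A'_face i A'a).
exact: supportedS (P_mono A'a (m := k)) fi.
Qed.

(** The image of the boundary of [a] is a cycle in the carrier of [a], by [P_mono], and acyclicity
    fills it. Choosing fillings with [xget] makes the recursion total; that the chosen sets are
    inhabited is shown afterwards. *)
Theorem carrier_existence :
  exists f, [/\ chain_on f, aug_on f & carried f].
Proof.
pose f := fix f k : A k -> {freeg (B k) / K} := match k with
  | 0 => fun a => xget 0 [set c : {freeg (B 0) / K} |
      supported (P 0 a 0) c /\ aug c = 1]
  | k'.+1 => fun a => xget 0 [set c : {freeg (B k'.+1) / K} |
      supported (P k'.+1 a k'.+1) c /\
      free_bdry c = fglift (f k') (cell_bdry K a)]
  end.
have f0 a : A' 0 a -> supported (P 0 a 0) (f 0 a) /\ aug (f 0 a) = 1.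
  move=> A'a; have [[v Pv] _ _] := P_acyclic A'a.
  apply: xget_and; exists << v >>; [exact: supportedU|exact: augU].
(* Two consecutive degrees are treated at once: the boundary formula in degree [k.+1] is what makes
   the chain to be filled in the next degree a cycle. *)
suff fP k : (forall a, A' k a -> supported (P k a k) (f k a)) /\
    (forall a, A' k.+1 a -> supported (P k.+1 a k.+1) (f k.+1 a) /\
       free_bdry (f k.+1 a) = fglift (f k) (cell_bdry K a)).
  exists f; split=> [k a A'a|a /f0[]//|k a A'a]; last exact: (fP k).1.
  by have [_ /(_ _ A'a)[]] := fP k.
elim: k => [|k [fS fB]].
  split=> [a /f0[]//|a A'a]; have [_ Pa _] := P_acyclic A'a.
  have [||e eP eB] := Pa (fglift (f 0) (cell_bdry K a)).
  - by apply: carried_bdry_subproof A'a => b /f0[].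
  - rewrite aug_lift ?aug_cell_bdry//; first by move=> b /f0[].
    exact: supported_cell_bdry.
  by apply: xget_and; exists e.
split=> [a /fB[]//|a A'a]; have [_ _ Pa] := P_acyclic A'a.
have [||e eP eB] := Pa k (fglift (f k.+1) (cell_bdry K a)).
- by apply: carried_bdry_subproof A'a => b /fB[].
- rewrite bdry_lift_subproof; last exact: supported_cell_bdry.
    by rewrite free_bdry_cell linear0.
  by move=> b /fB[].
by apply: xget_and; exists e.
Qed.

(** The same recursion as for existence: [g - f - h] of the boundary is a cycle in the carrier
    because the formula one degree lower cancels the boundary of [g - f]. *)
Theorem carrier_homotopy f g : chain_on f -> chain_on g ->
  aug_on f -> aug_on g -> carried f -> carried g ->
  exists h : forall k, A k -> {freeg (B k.+1) / K},
  [/\ forall k a, A' k a -> supported (P k a k.+1) (h k a),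
      forall a, A' 0 a -> free_bdry (h 0 a) = g 0 a - f 0 a &
      forall k a, A' k.+1 a -> free_bdry (h k.+1 a) =
        g k.+1 a - f k.+1 a - fglift (h k) (cell_bdry K a)].
Proof.
move=> fB gB f1 g1 fC gC.
pose h := fix h k : A k -> {freeg (B k.+1) / K} := match k with
  | 0 => fun a => xget 0 [set c : {freeg (B 1) / K} |
      supported (P 0 a 1) c /\ free_bdry c = g 0 a - f 0 a]
  | k'.+1 => fun a => xget 0 [set c : {freeg (B k'.+2) / K} |
      supported (P k'.+1 a k'.+2) c /\
      free_bdry c = g k'.+1 a - f k'.+1 a - fglift (h k') (cell_bdry K a)]
  end.
have h0 a : A' 0 a -> supported (P 0 a 1) (h 0 a) /\
    free_bdry (h 0 a) = g 0 a - f 0 a.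
  move=> A'a; have [_ Pa _] := P_acyclic A'a.
  have [||e eP eB] := Pa (g 0 a - f 0 a).
  - by apply: supportedB; [exact: gC|exact: fC].
  - by rewrite linearB /= f1// g1// subrr.
  by apply: xget_and; exists e.
have hSup k (a : A k.+1) : (forall b,
  A' k b -> supported (P k b k.+1) (h k b)) ->
    A' k.+1 a -> supported (P k.+1 a k.+1) (fglift (h k) (cell_bdry K a)).
  move=> hS A'a; rewrite linear_sum; apply: supported_sum => i _ _.
  rewrite linearZ; apply: supportedZ => /=; rewrite fglift1.
  have hi := hS _ (A'_face i A'a).
  exact: supportedS (P_mono A'a (m := k.+1)) hi.
suff hP k : (forall a, A' k a -> supported (P k a k.+1) (h k a)) /\
    (forall a, A' k.+1 a -> supported (P k.+1 a k.+2) (h k.+1 a) /\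
       free_bdry (h k.+1 a) =
         g k.+1 a - f k.+1 a - fglift (h k) (cell_bdry K a)).
  exists h; split=> [k|a /h0[]//|k a A'a]; first exact: (hP k).1.
  by have [_ /(_ _ A'a)[]] := hP k.
elim: k => [|k [hS hB]].
  split=> [a /h0[]//|a A'a]; have [_ _ Pa] := P_acyclic A'a.
  have [||e eP eB] := Pa 0%N (g 1%N a - f 1%N a - fglift (h 0) (cell_bdry K a)).
  - apply: supportedB; last by apply: hSup => // b /h0[].
    by apply: supportedB; [exact: gC|exact: fC].
  - have ca := supported_cell_bdry (K := K) A'_face A'a.
    have hgf : free_bdry (fglift (h 0) (cell_bdry K a)) =
        fglift (g 0) (cell_bdry K a) - fglift (f 0) (cell_bdry K a).
      apply: (@eq_supported K _ _ (A' 0) (@free_bdry K B 1 \o fglift (h 0))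
        (fglift (g 0) \- fglift (f 0))) => // b A'b /=.
      by rewrite !fglift1; exact: (h0 _ A'b).2.
    rewrite !linearB /=.
    by move: hgf (gB _ _ A'a) (fB _ _ A'a) => /= -> -> ->; exact: subrr.
  by apply: xget_and; exists e.
split=> [a /hB[]//|a A'a]; have [_ _ Pa] := P_acyclic A'a.
have [||e eP eB] :=
    Pa k.+1 (g k.+2 a - f k.+2 a - fglift (h k.+1) (cell_bdry K a)).
- apply: supportedB; last by apply: hSup => // b /hB[].
  by apply: supportedB; [exact: gC|exact: fC].
- have ca := supported_cell_bdry (K := K) A'_face A'a.
  have hgf : free_bdry (fglift (h k.+1) (cell_bdry K a)) =
      fglift (g k.+1) (cell_bdry K a) - fglift (f k.+1) (cell_bdry K a)
      - fglift (h k) (free_bdry (cell_bdry K a)).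
    apply: (@eq_supported K _ _ (A' k.+1) (@free_bdry K B k.+2 \o fglift (h
      k.+1))
      (fglift (g k.+1) \- fglift (f k.+1) \- (fglift (h k) \o @free_bdry K A
        k.+1)))
      => // b A'b /=.
    by rewrite !fglift1; exact: (hB _ A'b).2.
  rewrite free_bdry_cell linear0 subr0 in hgf; rewrite !linearB /=.
  by move: hgf (gB _ _ A'a) (fB _ _ A'a) => /= -> -> ->; exact: subrr.
by apply: xget_and; exists e.
Qed.

(** On a cycle the homotopy itself is a filling of the difference. [Q] records where this filling
    lives, which matters when it is to be mapped further by a map defined on [Q] only. *)
Corollary carrier_homologous f g k (c : {freeg (A k) / K}) (Q : set (B k.+1)) :
  chain_on f -> chain_on g -> aug_on f -> aug_on g -> carried f -> carried g ->
  (forall a, A' k a -> P k a k.+1 `<=` Q) ->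
  supported (A' k) c -> free_bdry c = 0 ->
  exists2 e : {freeg (B k.+1) / K}, supported Q e &
    free_bdry e = fglift (g k) c - fglift (f k) c.
Proof.
move=> fB gB f1 g1 fC gC PQ cA c0.
have [h [hS h0 hB]] := carrier_homotopy fB gB f1 g1 fC gC.
exists (fglift (h k) c).
  by apply: supported_lift cA _ => a A'a;
    apply: supportedS (PQ _ A'a) (hS _ _ A'a).
case: k c {Q PQ} cA c0 => [|k] c cA c0.
  apply: (@eq_supported K _ _ (A' 0) (@free_bdry K B 1 \o fglift (h 0))
    (fglift (g 0) \- fglift (f 0))) => // b A'b /=.
  by rewrite !fglift1; exact: h0.
transitivity (fglift (g k.+1) c - fglift (f k.+1) c - fglift (h k) (free_bdry
  c)).
  apply: (@eq_supported K _ _ (A' k.+1) (@free_bdry K B k.+2 \o fglift (h k.+1))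
    (fglift (g k.+1) \- fglift (f k.+1) \- (fglift (h k) \o @free_bdry K A
      k.+1)))
    => // b A'b /=.
  by rewrite !fglift1; exact: hB.
by rewrite [free_bdry c]c0 linear0 subr0.
Qed.

End Carriers.

Arguments free_bdry : simpl never.
Arguments face : simpl never.
Arguments cell : simpl never.
Arguments cell_fun : simpl never.

(** * Tuples, cones and prisms *)

Section Tuples.
Variable K : fieldType.
Implicit Types Z Y : choiceType.

Definition tuple_face Z k (h : 'I_k.+2) (s : {ffun 'I_k.+2 -> Z}) :
  {ffun 'I_k.+1 -> Z} := [ffun l => s (lift h l)].

Lemma tuple_faceK Z k (i j : 'I_k.+2) (s : {ffun 'I_k.+3 -> Z}) : (i <= j)%N ->
  tuple_face i (tuple_face (lift ord0 j) s) =
  tuple_face j (tuple_face (widen_ord (leqnSn _) i) s).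
Proof. by move=> ij; apply/ffunP => l; rewrite !ffunE lift_lift. Qed.

(** Repetitions and arbitrary orders are allowed, so that any map of sets induces a semi-simplicial
    map. *)
Definition tuples Z : semisimplicial :=
  @SemiSimplicial (fun k => {ffun 'I_k.+1 -> Z}) _ (@tuple_faceK Z).

Definition tuple_map_fun Z Z' (f : Z -> Z') k (s : tuples Z k) : tuples Z' k :=
  [ffun i => f (s i)].

Lemma tuple_map_face Z Z' (f : Z -> Z') k (i : 'I_k.+2) (s : tuples Z k.+1) :
  tuple_map_fun f (face i s) = face i (tuple_map_fun f s).
Proof. by apply/ffunP => l; rewrite !ffunE. Qed.

Definition tuple_map Z Z' (f : Z -> Z') :
  semisimplicial_map (tuples Z) (tuples Z') :=
  SemiSimplicialMap (tuple_map_face f).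

Lemma tuple_mapE Z Z' (f : Z -> Z') k (s : tuples Z k) i :
  tuple_map f k s i = f (s i).
Proof. exact: ffunE. Qed.

Lemma tuple_faceE Z k h (s : tuples Z k.+1) i : face h s i = s (lift h i).
Proof. exact: ffunE. Qed.

Lemma face_tuple_map Z Z' (f : Z -> Z') k h (s : tuples Z k.+1) :
  face h (tuple_map f k.+1 s) = tuple_map f k (face h s).
Proof. by rewrite [RHS]cell_funP. Qed.

Definition tuple_cone Z (x : Z) k (s : tuples Z k) : tuples Z k.+1 :=
  [ffun i => oapp s x (unlift ord0 i)].

Lemma face0_cone Z (x : Z) k (s : tuples Z k) :
  face ord0 (tuple_cone x s) = s.
Proof. by apply/ffunP => l; rewrite !ffunE liftK. Qed.

Lemma lift_lift0 k (j : 'I_k.+2) (l : 'I_k.+1) :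
  lift (lift ord0 j) (lift ord0 l) = lift ord0 (lift j l).
Proof. by rewrite lift_lift//; congr lift; apply/val_inj. Qed.

Lemma lift_lift00 k (j : 'I_k.+1) : lift (lift ord0 j) ord0 = ord0 :> 'I_k.+2.
Proof. exact/val_inj. Qed.

Lemma faceS_cone Z (x : Z) k (s : tuples Z k.+1) (j : 'I_k.+2) :
  face (lift ord0 j) (tuple_cone x s) = tuple_cone x (face j s).
Proof.
apply/ffunP => l; rewrite !ffunE.
have [l' ->|->] := unliftP ord0 l; last by rewrite lift_lift00 unlift_none.
by rewrite lift_lift0 liftK /= ffunE.
Qed.

Lemma cone_head Z k (s : tuples Z k.+1) : tuple_cone (s ord0) (face ord0 s) = s.
Proof.
apply/ffunP => l; rewrite !ffunE.
by have [l' ->|->] := unliftP ord0 l; rewrite //= ffunE.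
Qed.

Lemma tuple_map_cone Z Z' (f : Z -> Z') x k (s : tuples Z k) :
  tuple_map f k.+1 (tuple_cone x s) = tuple_cone (f x) (tuple_map f k s).
Proof.
by apply/ffunP => l; rewrite !ffunE; case: unlift => //= i; rewrite ffunE.
Qed.

Lemma cell_bdry_recl (A : semisimplicial) k (s : A k.+1) :
  cell_bdry K s = << face ord0 s >> -
    \sum_(j < k.+1) (-1) ^+ j *: << face (lift ord0 j) s >>.
Proof.
rewrite /cell_bdry big_ord_recl expr0 scale1r; congr (_ + _).
rewrite -sumrN; apply: eq_bigr => j _.
by rewrite /= [bump 0 j]add1n exprS mulN1r scaleNr.
Qed.

Definition cone Z (x : Z) k : {freeg (tuples Z k) / K} -> {freeg (tuples Z
  k.+1) / K} :=
  fglift (fun s => << tuple_cone x s >>).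
HB.instance Definition _ Z (x : Z) k := GRing.isLinear.Build K
  {freeg (tuples Z k) / K} {freeg (tuples Z k.+1) / K} *:%R (@cone Z x k)
  (fglift_linear _).

Lemma coneU Z (x : Z) k (s : tuples Z k) : cone x << s >> = << tuple_cone x s
  >>.
Proof. exact: fglift1. Qed.

Lemma cell_bdry_cone0 Z (x : Z) (s : tuples Z 0) :
  cell_bdry K (tuple_cone x s) = << s >> - << ([ffun=> x] : tuples Z 0) >>.
Proof.
rewrite cell_bdry_recl face0_cone big_ord1 expr0 scale1r; congr (_ - << _ >>).
apply/ffunP => l; rewrite !ffunE.
by rewrite (_ : lift _ _ = ord0) ?unlift_none//; apply/val_inj;
  rewrite /= !ord1.
Qed.

Lemma cell_bdry_cone Z (x : Z) k (s : tuples Z k.+1) :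
  cell_bdry K (tuple_cone x s) = << s >> - cone x (cell_bdry K s).
Proof.
rewrite cell_bdry_recl face0_cone; congr (_ - _).
rewrite /cell_bdry linear_sum; apply: eq_bigr => j _.
by rewrite linearZ /= coneU faceS_cone.
Qed.

Lemma bdry_cone Z (x : Z) k (c : {freeg (tuples Z k.+1) / K}) :
  free_bdry (cone x c) = c - cone x (free_bdry c).
Proof.
apply: (@eq_supported K _ _ setT (@free_bdry K (tuples Z) k.+2 \o @cone Z x
  k.+1)
  (idfun \- (@cone Z x k \o @free_bdry K (tuples Z) k.+1))) => //= s _.
by rewrite coneU !free_bdryU cell_bdry_cone.
Qed.

Definition tuples_in Z (F : set Z) : cells (tuples Z) :=
  fun k s => forall i, F (s i).

Lemma tuples_in_face_closed Z (F : set Z) : face_closed (tuples_in F).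
Proof. by move=> k h s sF i; rewrite ffunE. Qed.

Lemma cone_acyclic Z (P : cells (tuples Z)) (x : Z) : face_closed P ->
  P 0 [ffun=> x] -> (forall k s,
    P k s -> P k.+1 (tuple_cone x s)) -> acyclic K P.
Proof.
move=> Pf Px Pc.
apply: (@contractible_acyclic _ _ _ _ (fun k s => << tuple_cone x s >>) Pf Px).
- by move=> k s /Pc; exact: supportedU.
- by move=> s _; rewrite free_bdryU cell_bdry_cone0.
- by move=> k s _; rewrite free_bdryU cell_bdry_cone.
Qed.

Lemma tuples_in_acyclic Z (F : set Z) : F !=set0 -> acyclic K (tuples_in F).
Proof.
move=> [x Fx]; apply: (@cone_acyclic _ _ x (@tuples_in_face_closed _ F)).
  by move=> i; rewrite ffunE.
by move=> k s Fs i; rewrite ffunE; case: unlift => //=.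
Qed.

Section Prism.
Variables (Z Z' : choiceType) (a b : Z -> Z').

(** The usual prism operator, the alternating sum of the tuples
    [a s_0, ..., a s_i, b s_i, ..., b s_k], written recursively with cones so that [bdry_cone]
    computes its boundary. *)
Fixpoint prism k : tuples Z k -> {freeg (tuples Z' k.+1) / K} :=
  match k with
  | 0 => fun s => << tuple_cone (a (s ord0)) (tuple_map b 0 s) >>
  | k'.+1 => fun s => << tuple_cone (a (s ord0)) (tuple_map b k'.+1 s) >> -
      cone (a (s ord0)) (prism (face ord0 s))
  end.

Arguments prism : simpl never.

Lemma bdry_prism0 s :
  free_bdry (prism (k := 0) s) = << tuple_map b 0 s >> - << tuple_map a 0 s >>.
Proof.
rewrite /prism free_bdryU cell_bdry_cone0; congr (_ - << _ >>).
by apply/ffunP => l; rewrite tuple_mapE ffunE (ord1 (l : 'I_1));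
  congr (a (s _)); apply/val_inj.
Qed.

Lemma prismS k s : prism (k := k.+1) s =
  cone (a (s ord0)) (<< tuple_map b k.+1 s >> - prism (face ord0 s)).
Proof. by rewrite linearB /= coneU. Qed.

Lemma face_face0 k (s : tuples Z k.+2) (j : 'I_k.+2) :
  face ord0 (face (lift ord0 j) s) = face j (face ord0 s).
Proof. by rewrite faceK//; congr (face j (face _ s)); apply/val_inj. Qed.

Lemma bdry_prism k s :
  free_bdry (prism (k := k.+1) s) = << tuple_map b k.+1 s >> -
    << tuple_map a k.+1 s >> - fglift (@prism k) (cell_bdry K s).
Proof.
have faceS0 m (t : tuples Z m.+1) j : (face (lift ord0 j) t) ord0 = t ord0.
  by rewrite ffunE lift_lift00.
have a_head m (t : tuples Z m.+1) : cone (a (t ord0)) << tuple_map a m (face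
  ord0 t) >> =
    << tuple_map a m.+1 t >>.
  by rewrite coneU -tuple_map_cone cone_head.
(* [bdry_cone] reduces the claim to the boundary of what lies under the outer cone; the summand
   [prism (face ord0 t)] outside it is the zeroth term of the prism over the boundary. *)
have red m (t : tuples Z m.+1) :
    cone (a (t ord0)) (free_bdry (<< tuple_map b m.+1 t >> - prism (face ord0
      t))) =
    << tuple_map a m.+1 t >> -
    \sum_(j < m.+1) (-1) ^+ j *: prism (face (lift ord0 j) t) ->
    free_bdry (prism t) = << tuple_map b m.+1 t >> -
    << tuple_map a m.+1 t >> - fglift (@prism m) (cell_bdry K t).
  move=> E; rewrite prismS bdry_cone E.
  have -> : fglift (@prism m) (cell_bdry K t) = prism (face ord0 t) -
      \sum_(j < m.+1) (-1) ^+ j *: prism (face (lift ord0 j) t).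
    rewrite cell_bdry_recl linearB linear_sum /= fglift1; congr (_ - _).
    by apply: eq_bigr => j _; rewrite linearZ /= fglift1.
  rewrite !opprB [_ - << tuple_map a _ _ >>]addrC addrACA; congr (_ + _).
  exact: addrC.
elim: k s => [|k IH] s; apply: red.
  rewrite [free_bdry _]linearB /= bdry_prism0 free_bdryU cell_bdry_recl
    !big_ord1 expr0 !scale1r.
  rewrite !face_tuple_map opprB addrC -!addrA addKr !linearB /= a_head.
  by rewrite coneU [prism (face _ _)]/prism faceS0.
rewrite [free_bdry _]linearB /= IH free_bdryU cell_bdry_recl.
rewrite face_tuple_map -(a_head _ s).
have -> (B S1 A S2 : {freeg (tuples Z' k.+1) / K}) :
    B - S1 - (B - A - S2) = A - (S1 - S2).
  rewrite !opprB [S2 + _]addrC addrACA [B + _]addrC subrK; congr (_ + _).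
  exact: addrC.
rewrite linearB; congr (_ - _).
rewrite /cell_bdry linear_sum -sumrB linear_sum; apply: eq_bigr => j _.
rewrite prismS faceS0 face_tuple_map face_face0 !linearZ /= fglift1.
by rewrite -scalerDr linearZ.
Qed.

Lemma supported_prism k (s : tuples Z k) :
  supported [set t : tuples Z' k.+1 | forall i,
    (exists j, t i = a (s j)) \/ (exists j, t i = b (s j))] (prism s).
Proof.
elim: k s => [|k IH] s.
  apply: supportedU => i; rewrite ffunE.
  by case: unliftP => [j _|_] /=; [right; exists j; rewrite tuple_mapE|left;
    exists ord0].
rewrite prismS; apply: (supported_lift (P := [set t : tuples Z' k.+1 | forall i,
    (exists j, t i = a (s j)) \/ (exists j, t i = b (s j))])).
  apply: supportedB.
    by apply: supportedU => i; right; exists i; rewrite tuple_mapE.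
  apply: supportedS (IH (face ord0 s)) => t tP i.
  by case: (tP i) => -[j ->]; [left|right]; exists (lift ord0 j);
    rewrite tuple_faceE.
move=> t tP; apply: supportedU => i; rewrite ffunE.
by case: unliftP => [j _|_] /=; [exact: tP|left; exists ord0].
Qed.

Lemma prism_homotopy k (c : {freeg (tuples Z k) / K}) : free_bdry c = 0 ->
  free_bdry (fglift (@prism k) c) =
  free_fun (tuple_map b) c - free_fun (tuple_map a) c.
Proof.
case: k c => [|k] c c0.
  apply: (@eq_supported K _ _ setT (@free_bdry K (tuples Z') 1 \o fglift
    (@prism 0))
    (@free_fun K _ _ (tuple_map b) 0 \- @free_fun K _ _ (tuple_map a) 0)) =>
      //= s _.
  by rewrite /free_fun !fglift1; exact: bdry_prism0.
transitivity (free_fun (tuple_map b) c - free_fun (tuple_map a) c -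
  fglift (@prism k) (free_bdry c));
    last by rewrite [free_bdry c]c0 linear0 subr0.
apply: (@eq_supported K _ _ setT (@free_bdry K (tuples Z') k.+2 \o fglift
  (@prism k.+1))
  (@free_fun K _ _ (tuple_map b) k.+1 \- @free_fun K _ _ (tuple_map a) k.+1 \-
  (fglift (@prism k) \o @free_bdry K (tuples Z) k.+1))) => //= s _.
by rewrite /free_fun !fglift1 bdry_prism free_bdryU.
Qed.

End Prism.

Lemma free_fun_cone Z Z' (f : Z -> Z') x k (c : {freeg (tuples Z k) / K}) :
  free_fun (tuple_map f) (cone x c) = cone (f x) (free_fun (tuple_map f) c).
Proof.
apply: (@eq_supported K _ _ setT (@free_fun K _ _ (tuple_map f) k.+1 \o cone x
  (k := k))
  (@cone _ (f x) k \o @free_fun K _ _ (tuple_map f) k)) => //= s _.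
by rewrite coneU /free_fun !fglift1 coneU tuple_map_cone.
Qed.

(** Naturality of the prism, needed to match the prism over a face of a simplex with the
    corresponding part of the prism over the simplex. *)
Lemma free_fun_prism Z Z' Y Y' (a b : Z -> Z') (a' b' : Y -> Y') (f : Z -> Y)
    (f' : Z' -> Y') k (s : tuples Z k) :
  (forall z, f' (a z) = a' (f z)) -> (forall z, f' (b z) = b' (f z)) ->
  free_fun (tuple_map f') (prism a b s) = prism a' b' (tuple_map f k s).
Proof.
move=> fa fb.
have E m (t : tuples Z m) :
    tuple_map f' m (tuple_map b m t) = tuple_map b' m (tuple_map f m t).
  by apply/ffunP => i; rewrite !tuple_mapE.
elim: k s => [|k IH] s.
  rewrite /prism /free_fun fglift1 tuple_map_cone fa tuple_mapE.
  by rewrite E.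
rewrite !prismS free_fun_cone linearB /= IH face_tuple_map tuple_mapE fa.
rewrite {1}/free_fun fglift1.
by rewrite E.
Qed.
End Tuples.

(** * Acyclicity of the ordered simplices with vertices in a given simplex *)

Section OrderedFullSimplex.
Variables (K : fieldType) (d : Order.disp_t) (V : orderType d).
Variable C : simplicial_complex V.

Lemma fset_min (F : {fset V}) : F != fset0 ->
  exists2 m, m \in F & forall x, x \in F -> (m <= x)%O.
Proof.
suff h (r : seq V) : r != [::] ->
    exists2 m, m \in r & forall x, x \in r -> (m <= x)%O.
  by move=> F0; apply: h; rewrite -size_eq0 cardfs_eq0.
elim: r => // y [|z r] IH _.
  by exists y; [exact: mem_head|move=> x; rewrite inE => /eqP ->].
have [//|m mr mmin] := IH.
have [ym|my] := leP y m.
  by exists y; [exact: mem_head|move=> x /predU1P[->//|/mmin]; exact: le_trans].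
exists m; first by rewrite inE mr orbT.
by move=> x /predU1P[->|/mmin//]; exact: ltW.
Qed.

Definition full_simplex (F : {fset V}) : cells (ordered_set C) :=
  fun k s => forall i, val s i \in F.

Lemma full_simplex_face_closed F : face_closed (full_simplex F).
Proof. by move=> k h s sF i; rewrite ffunE. Qed.

Lemma ordered_simplex_lt k (s : ordered_set C k) (i j : 'I_k.+1) :
  (i < j)%N -> (val s i < val s j)%O.
Proof.
case: s => s /= /andP[/forallP incr _] ij.
exact: (implyP (forallP (incr i) j)).
Qed.

Lemma ordered_simplexP k (s : ordered_set C k) :
  simplex_set C [fset val s i | i in 'I_k.+1]%fset.
Proof. by case: s => s /= /andP[_ /asboolP]. Qed.

Lemma ordered_simplex_pred_in (F : {fset V}) k (s : {ffun 'I_k.+1 -> V}) :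
  simplex_set C F -> (forall i, s i \in F) ->
  (forall i j : 'I_k.+1, (i < j)%N -> (s i < s j)%O) -> ordered_simplex_pred C
    s.
Proof.
move=> CF sF sI; apply/andP; split.
  by apply/forallP => i; apply/forallP => j; apply/implyP; exact: sI.
apply/asboolP; apply: simplex_sub CF _ _.
  by apply/fsubsetP => _ /imfsetP[l /= _ ->].
by apply/fset0Pn; exists (s ord0); apply/imfsetP; exists ord0.
Qed.

(** Cone from the least vertex [m] of [F]: prepending [m] keeps a tuple increasing unless the tuple
    already starts with [m], and then [insub] fails and the cone is 0. *)
Lemma full_simplex_acyclic (F : {fset V}) : simplex_set C F -> acyclic K
  (full_simplex F).
Proof.
move=> CF; have [m mF mmin] := fset_min (simplex_neq0 CF).
have vP : ordered_simplex_pred C ([ffun=> m] : {ffun 'I_1 -> V}).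
  apply: (ordered_simplex_pred_in CF) => [i|i j]; first by rewrite ffunE.
  by rewrite !ord1.
pose v : ordered_set C 0 := exist (fun s => ordered_simplex_pred C s) _ vP.
pose h k (s : ordered_set C k) : {freeg (ordered_set C k.+1) / K} :=
  if insub (tuple_cone m (val s : tuples V k)) is Some t then << t >> else 0.
have hgt k (s : ordered_set C k) : full_simplex F s -> (m < val s ord0)%O ->
    exists2 t : ordered_set C k.+1, h k s = << t >> &
      val t = tuple_cone m (val s : tuples V k).
  move=> sF ms; have tP : ordered_simplex_pred C (tuple_cone m (val s : tuples
    V k)).
    apply: (ordered_simplex_pred_in CF) => [i|i j].
      by rewrite ffunE; case: unliftP => [l _|_] /=; [exact: sF|exact: mF].
    rewrite !ffunE; case: (unliftP ord0 j) => [j' ->|->]; last by rewrite ltn0.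
    case: (unliftP ord0 i) => [i' ->|-> _] /=.
      by rewrite /bump !add1n ltnS; exact: ordered_simplex_lt.
    apply: lt_le_trans ms _; have [->//|j0] := eqVneq j' ord0.
    by apply/ltW/ordered_simplex_lt; rewrite /= lt0n.
  exists (exist (fun s => ordered_simplex_pred C s) _ tP) => //.
  by rewrite /h; case: insubP => [t' _ tt'|]; [congr << _ >>;
    exact/val_inj|rewrite tP].
have heq k (s : ordered_set C k) : val s ord0 = m -> h k s = 0.
  move=> s0; rewrite /h; case: insubP => // t _ tE.
  have := @ordered_simplex_lt k.+1 t ord0 (lift ord0 ord0) isT.
  by rewrite tE !ffunE unlift_none liftK /= s0 ltxx.
have cases k (s : ordered_set C k) : full_simplex F s ->
    val s ord0 = m \/ (m < val s ord0)%O.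
  by move=> sF; have := mmin _ (sF ord0); rewrite le_eqVlt => /predU1P[];
    [left|right].
apply: (@contractible_acyclic _ _ _ v h).
- exact: full_simplex_face_closed.
- by move=> i; rewrite ffunE.
- move=> k s sF; have [/heq ->|] := cases k s sF; first exact: supported0.
  move=> /(hgt _ _ sF)[t -> tE]; apply: supportedU => i; rewrite tE ffunE.
  by case: unliftP => [l _|_] /=; [exact: sF|exact: mF].
- move=> s sF; have [s0|] := cases _ s sF.
    rewrite heq// linear0; suff -> : s = v by rewrite subrr.
    by apply/val_inj/ffunP => i; rewrite ord1 /= ffunE.
  move=> /(hgt _ _ sF)[t -> tE];
    rewrite free_bdryU cell_bdry_recl big_ord1 expr0 scale1r.
  congr (<< _ >> - << _ >>); apply/val_inj/ffunP => i;
    rewrite /= ffunE tE ffunE.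
    by rewrite liftK.
  rewrite ffunE (_ : lift _ _ = ord0) ?unlift_none//.
  by apply/val_inj; rewrite /= !ord1.
(* If [s] starts with [m], its cone is 0, all faces but the zeroth start with [m] and have cone 0,
   and the cone over the zeroth face is [s] again. Otherwise the cone over every face is a genuine
   simplex and the usual formula holds. *)
move=> k s sF; have [s0|ms] := cases _ s sF.
  rewrite heq// linear0; apply/esym/eqP; rewrite subr_eq0; apply/eqP.
  rewrite cell_bdry_recl linearB linear_sum /= fglift1 big1 ?subr0.
    have [|t -> tE] := hgt _ (face ord0 s) (full_simplex_face_closed _ sF).
      by rewrite ffunE -s0; exact: ordered_simplex_lt.
    congr << _ >>; apply/val_inj; rewrite tE -s0.
    exact: esym (cone_head (val s : tuples V k.+1)).
  by move=> j _; rewrite linearZ /= fglift1 heq ?scaler0// ffunE lift_lift00.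
have [t -> tE] := hgt _ _ sF ms; rewrite free_bdryU cell_bdry_recl.
congr (<< _ >> - _).
  apply/val_inj; transitivity (face ord0 (val t : tuples V k.+2)) => //.
  by rewrite tE face0_cone.
rewrite /cell_bdry linear_sum; apply: eq_bigr => j _;
  rewrite linearZ /= fglift1.
have [|t' -> tE'] := hgt _ (face j s) (full_simplex_face_closed _ sF).
  apply: lt_le_trans ms _; rewrite ffunE.
  have [->//|j0] := eqVneq (lift j ord0) ord0.
  by apply/ltW/ordered_simplex_lt; rewrite lt0n.
congr (_ *: << _ >>); apply/val_inj; rewrite tE'.
transitivity (face (lift ord0 j) (val t : tuples V k.+2)) => //.
by rewrite tE faceS_cone.
Qed.

End OrderedFullSimplex.

Notation simplex R k := (set_type (@std_simplex R k)).

(** * Subdivision of the standard simplices *)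

Section Barycentric.
Variable R : realType.

Lemma simplex_ge0 k (t : simplex R k) i : 0 <= val t 0 i.
Proof. by case: t => t /= /set_mem[]. Qed.

Lemma simplex_sum1 k (t : simplex R k) : \sum_i val t 0 i = 1.
Proof. by case: t => t /= /set_mem[]. Qed.

Lemma simplex_le1 k (t : simplex R k) i : val t 0 i <= 1.
Proof.
rewrite -(simplex_sum1 t) (bigD1 i)//= lerDl.
by apply: sumr_ge0 => j _; exact: simplex_ge0.
Qed.

Definition bary (M : lmodType R) k (t : simplex R k) (p : 'I_k.+1 -> M) : M :=
  \sum_i val t 0 i *: p i.

Lemma bary_coface (M : lmodType R) k h (t : simplex R k) (p : 'I_k.+2 -> M) :
  bary (coface h t) p = bary t (p \o lift h).
Proof.
rewrite /bary (bigD1_ord h)//= mxE unlift_none scale0r add0r.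
by apply: eq_bigr => i _; rewrite mxE liftK.
Qed.

Lemma bary_const (M : lmodType R) k (t : simplex R k) (x : M) :
  bary t (fun=> x) = x.
Proof. by rewrite /bary -scaler_suml simplex_sum1 scale1r. Qed.

Lemma sbary_subproof k m (t : simplex R m) (p : 'I_m.+1 -> simplex R k) :
  bary t (fun i => val (p i)) \in @std_simplex R k.
Proof.
apply/mem_set; split=> [i|].
  rewrite summxE; apply: sumr_ge0 => j _; rewrite mxE.
  by apply: mulr_ge0; exact: simplex_ge0.
under eq_bigr do rewrite summxE.
rewrite exchange_big /= -[RHS](simplex_sum1 t); apply: eq_bigr => j _.
under eq_bigr do rewrite mxE.
by rewrite -mulr_sumr simplex_sum1 mulr1.
Qed.

Definition sbary k m (t : simplex R m) (p : 'I_m.+1 -> simplex R k) : simplex R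
  k :=
  exist _ (bary t (fun i => val (p i))) (sbary_subproof t p).

Lemma sbaryE k m (t : simplex R m) (p : 'I_m.+1 -> simplex R k) i :
  val (sbary t p) 0 i = \sum_j val t 0 j * val (p j) 0 i.
Proof. by rewrite summxE; apply: eq_bigr => j _; rewrite mxE. Qed.

Lemma sbary_coface k m (t : simplex R m) h (p : 'I_m.+2 -> simplex R k) :
  sbary (coface h t) p = sbary t (p \o lift h).
Proof. by apply/val_inj; rewrite /= bary_coface. Qed.

Lemma coface_sbary k m (t : simplex R m) h (p : 'I_m.+1 -> simplex R k) :
  coface h (sbary t p) = sbary t (coface h \o p).
Proof.
apply/val_inj/rowP => i; rewrite sbaryE /= mxE.
under eq_bigr do rewrite mxE.
by case: unlift => [j|] /=; [rewrite sbaryE|rewrite big1// => *; rewrite mulr0].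
Qed.

Lemma vertex_subproof k (i : 'I_k.+1) : delta_mx 0 i \in @std_simplex R k.
Proof.
apply/mem_set; split=> [j|]; first by rewrite mxE; case: (_ && _).
rewrite (bigD1 i)//= mxE !eqxx big1 ?addr0// => j ji.
by rewrite mxE (negbTE ji) andbF.
Qed.

Definition vertex k (i : 'I_k.+1) : simplex R k :=
  exist (fun x => x \in @std_simplex R k) (delta_mx 0 i) (vertex_subproof i).

(** The tautological tuple, which represents the undivided simplex: [sbary t (vertices k)] is
    [t]. *)
Definition vertices k : tuples (simplex R k) k := [ffun i => vertex i].

Lemma bary_vertex (M : lmodType R) k (i : 'I_k.+1) (p : 'I_k.+1 -> M) :
  bary (vertex i) p = p i.
Proof.
rewrite /bary (bigD1 i)//= mxE !eqxx scale1r big1 ?addr0// => j ji.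
by rewrite mxE (negbTE ji) andbF scale0r.
Qed.

Lemma sbary_vertices k (t : simplex R k) : sbary t (vertices k) = t.
Proof.
apply/val_inj/rowP => i; rewrite sbaryE (bigD1 i)//= ffunE mxE !eqxx mulr1.
rewrite big1 ?addr0// => j ji; rewrite ffunE /= mxE [i == j]eq_sym (negbTE ji).
by rewrite andbF mulr0.
Qed.

Lemma coface_vertex k h (i : 'I_k.+1) : coface h (vertex i) = vertex (lift h i).
Proof.
apply/val_inj/rowP => j; rewrite !mxE.
have [l ->|->] := unliftP h j; first by rewrite /= mxE (inj_eq lift_inj).
by rewrite (negbTE (neq_lift _ _)) andbF.
Qed.

Lemma face_vertices k h :
  face h (vertices k.+1) = tuple_map (coface h) k (vertices k).
Proof.
by apply/ffunP => i; rewrite tuple_faceE tuple_mapE !ffunE coface_vertex.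
Qed.

End Barycentric.
Arguments vertices {R} k.
Arguments vertex {R k} i.

Section Cofaces.
Variables (K : fieldType) (R : realType).
Local Notation chains m Z := {freeg (tuples Z m) / K}.

(** A copy of [c] on each face of the next simplex, with the signs of the boundary. Chains [s k]
    with [free_bdry (s k.+1) = cofaces (s k)] define a chain map on every natural family of
    simplices. *)
Definition cofaces k m (c : (chains m (simplex R k))) : (chains m (simplex R
  k.+1)) :=
  \sum_(i < k.+2) (-1) ^+ i *: free_fun (tuple_map (coface i)) c.

Lemma cofaces_linear k m : linear (@cofaces k m).
Proof.
move=> a c e; rewrite /cofaces scaler_sumr -big_split; apply: eq_bigr => i _ /=.
by rewrite linearP scalerDr !scalerA mulrC.
Qed.
HB.instance Definition _ k m := GRing.isLinear.Build K _ _ *:%R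
  (@cofaces k m) (@cofaces_linear k m).

Lemma free_fun_tuple_comp (Z Y W : choiceType) (g : Z -> Y) (f : Y -> W) (h : Z
  -> W) m (c : (chains m (Z))) :
  (forall z, f (g z) = h z) ->
  free_fun (tuple_map f) (free_fun (tuple_map g) c) = free_fun (tuple_map h) c.
Proof.
move=> fg; apply: (@eq_supported K _ _ setT
  (@free_fun K _ _ (tuple_map f) m \o @free_fun K _ _ (tuple_map g) m)
  (@free_fun K _ _ (tuple_map h) m)) => //= s _.
rewrite /free_fun !fglift1; congr << _ >>.
by apply/ffunP => i; rewrite !tuple_mapE.
Qed.

(** The signs cancel as in the square of the boundary, so the identity is transported from there:
    [G] pushes [c] along singular simplices of the standard simplex, and is applied to the double
    boundary of the identity [iota]. *)
Lemma cofacesK k m (c : (chains m (simplex R k))) : cofaces (cofaces c) = 0.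
Proof.
pose D : topologicalType := simplex R k.+2.
pose G : {freeg (singular_set R D k) / K} -> (chains m D) :=
  fglift (fun s : continuousType (simplex R k) D => free_fun (tuple_map s) c).
pose iota : singular_set R D k.+2 :=
  [the continuousType (simplex R k.+2) D of idfun].
have G0 : G (free_bdry (cell_bdry K iota)) = 0 by rewrite free_bdry_cell /G
  linear0.
have E : free_bdry (cell_bdry K iota) =
    \sum_(i < k.+3) (-1) ^+ i *: cell_bdry K (face i iota).
  rewrite [in LHS]/cell_bdry linear_sum; apply: eq_bigr => i _.
  by rewrite linearZ /= free_bdryU.
rewrite -[RHS]G0 E {1}/cofaces /G [RHS]linear_sum; apply: eq_bigr => i _.
rewrite [RHS]linearZ /=; congr (_ *: _).
rewrite /cofaces /cell_bdry !linear_sum.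
apply: eq_bigr => j _; rewrite !linearZ /= fglift1; congr (_ *: _).
exact: free_fun_tuple_comp.
Qed.

Lemma bdry_cofaces k m (c : chains m.+1 (simplex R k)) :
  free_bdry (cofaces c) = cofaces (free_bdry c).
Proof.
rewrite linear_sum; apply: eq_bigr => i _; rewrite linearZ /=.
by congr (_ *: _); rewrite -free_funP.
Qed.

Lemma aug_cofaces0 (c : chains 0 (simplex R 0)) : aug (cofaces c) = 0.
Proof.
apply: (@eq_supported K _ _ setT (@aug K _ \o @cofaces 0 0) \0) => //= s _.
rewrite /cofaces !big_ord_recl big_ord0 addr0 expr0 scale1r expr1 scaleN1r.
by rewrite linearB /= /free_fun !fglift1 !augU subrr.
Qed.

End Cofaces.

Section SmallTuples.
Variables (K : fieldType) (R : realType).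
Local Notation chains m Z := {freeg (tuples Z m) / K}.

Lemma aug_free_fun (A B : semisimplicial) (f : semisimplicial_map A B)
    (c : {freeg (A 0) / K}) : aug (free_fun f c) = aug c.
Proof.
apply: (@eq_supported K _ _ setT (@aug K _ \o @free_fun K _ _ f 0) (@aug K _))
  => //.
by move=> s _ /=; rewrite /free_fun fglift1 !augU.
Qed.

Lemma eq_free_fun (A B : semisimplicial) (f g : semisimplicial_map A B) m
    (c : {freeg (A m) / K}) : f m =1 g m -> free_fun f c = free_fun g c.
Proof.
move=> fg; apply: (@eq_supported K _ _ setT (@free_fun K _ _ f m)
  (@free_fun K _ _ g m)) => // s _.
by rewrite /= /free_fun !fglift1 fg.
Qed.

Lemma free_fun_tuple_id (Z : choiceType) (f : Z -> Z) m (c : chains m Z) :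
  f =1 id -> free_fun (tuple_map f) c = c.
Proof.
move=> fid; apply: (@eq_supported K _ _ setT (@free_fun K _ _ (tuple_map f) m)
  idfun) => //.
move=> s _; rewrite /= /free_fun fglift1; congr << _ >>.
by apply/ffunP => i; rewrite tuple_mapE fid.
Qed.

Definition small (eta : R) k : cells (tuples (simplex R k)) :=
  fun m s => forall i j l, `|val (s i) 0 l - val (s j) 0 l| < eta.

Lemma small_coface eta k h m (s : tuples (simplex R k) m) : 0 < eta ->
  small eta s -> small eta (tuple_map (coface h) m s).
Proof.
move=> eta0 sP i j l; rewrite !tuple_mapE !mxE.
by case: unlift => [l'|] /=; [exact: sP|rewrite subrr normr0].
Qed.

(** A chain involves finitely many tuples, so the strict bound [eta] can be lowered to a common [d];
    the gap [eta - d] is the room for one step of a contraction. *)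
Lemma small_bound eta k m (c : chains m (simplex R k)) : 0 < eta ->
  supported (@small eta k m) c ->
  exists2 d, d < eta & forall s, s \in dom c -> forall i j l,
    `|val (s i) 0 l - val (s j) 0 l| <= d.
Proof.
move=> eta0; rewrite /supported; elim: (dom c) => [|s r IH] h.
  by exists 0.
have [x xr|d deta dP] := IH; first by apply: h; rewrite inE xr orbT.
pose d' := \big[Num.max/0]_(p : 'I_m.+1 * 'I_m.+1 * 'I_k.+1)
  `|val (s p.1.1) 0 p.2 - val (s p.1.2) 0 p.2|.
exists (Num.max d d').
  rewrite gt_max deta /=; apply/bigmax_ltP; split=> // p _.
  by apply: h; rewrite mem_head.
move=> x; rewrite inE => /predU1P[->|/dP xP] i j l; rewrite le_max;
  last by rewrite xP.
apply/orP; right.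
exact: (le_bigmax _ (fun p : 'I_m.+1 * 'I_m.+1 * 'I_k.+1 =>
  `|val (s p.1.1) 0 p.2 - val (s p.1.2) 0 p.2|) (i, j, l)).
Qed.

Definition contract k (u : R) (q : simplex R k) : simplex R k :=
  insubd (vertex ord0) ((1 - u) *: val q + u *: val (@vertex R k ord0)).

Lemma contractE k u (q : simplex R k) : 0 <= u <= 1 ->
  val (contract u q) = (1 - u) *: val q + u *: val (@vertex R k ord0).
Proof.
move=> /andP[u0 u1]; rewrite insubdK//; apply/mem_set; split=> [i|].
  by rewrite 3!mxE addr_ge0// mulr_ge0// ?simplex_ge0// subr_ge0.
under eq_bigr do rewrite 3!mxE.
by rewrite big_split -!mulr_sumr !simplex_sum1 !mulr1 /= subrK.
Qed.

Lemma contract_close k (u u' d : R) (q q' : simplex R k) l :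
  0 <= u <= 1 -> 0 <= u' <= 1 ->
  `|val q 0 l - val q' 0 l| <= d ->
  `|val (contract u q) 0 l - val (contract u' q') 0 l| <= d + `|u - u'|.
Proof.
move=> u01 u'01 qq'; rewrite !contractE// !mxE.
set x := sval q 0 l in qq' *; set x' := sval q' 0 l in qq' *.
set b := (_ && _)%:R.
have -> : (1 - u) * x + u * b - ((1 - u') * x' + u' * b) =
  (1 - u) * (x - x') + (u - u') * (b - x') by ring.
apply: le_trans (ler_normD _ _) _; rewrite !normrM; apply: lerD.
  apply: le_trans qq'; rewrite ger0_norm; last by lra.
  by rewrite ler_piMl//; lra.
rewrite ler_piMr// ler_norml.
have := simplex_ge0 q' l; have := simplex_le1 q' l.
rewrite -/x' => x'1 x'0.
have : 0 <= b <= 1 by rewrite /b ler0n lern1 leq_b1.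
by lra.
Qed.

(* A small cycle is contracted linearly to a vertex in [N] steps, each of them so
   short that its prism is still small: no subdivision is needed. *)
Lemma small_acyclic eta k : 0 < eta -> acyclic K (@small eta k).
Proof.
move=> eta0; pose b : simplex R k := vertex ord0.
have tinS m : @tuples_in _ [set b] m `<=` @small eta k m.
  by move=> s sb i j l; rewrite !sb subrr normr0.
have main m (c : chains m (simplex R k)) : supported (@small eta k m) c ->
    free_bdry c = 0 -> exists2 e : chains m.+1 (simplex R k),
    supported (@small eta k m.+1) e &
    free_bdry e = free_fun (tuple_map (fun=> b)) c - c.
  move=> cP c0; have [d deta dP] := small_bound eta0 cP.
  (* A step of length 1/N moves coordinates by at most 1/N, so this choice makes [d + N%:R^-1] less
     than [eta]. *)
  pose N := (Num.bound (eta - d)^-1).+1.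
  have N0 : 0 < N%:R :> R by rewrite ltr0n.
  have N1 : N%:R^-1 < eta - d.
    rewrite -[ltRHS]invrK ltf_pV2 ?posrE ?invr_gt0 ?subr_gt0//.
    apply: (lt_trans (archi_boundP _)); last by rewrite ltr_nat.
    by rewrite invr_ge0 subr_ge0 ltW.
  have step u u' : 0 <= u <= 1 -> 0 <= u' <= 1 -> `|u - u'| < eta - d ->
      exists2 e : chains m.+1 (simplex R k), supported (@small eta k m.+1) e &
      free_bdry e = free_fun (tuple_map (contract u')) c -
        free_fun (tuple_map (contract u)) c.
    move=> u01 u'01 uu'.
    exists (fglift (@prism K _ _ (contract u) (contract u') m) c); last first.
      exact: prism_homotopy.
    apply: (supported_lift (@supported_dom _ _ c)) => s /dP sP.
    apply: (supportedS _ (@supported_prism K _ _ (contract u) (contract u') _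
      s)) => t tP i j l.
    have [[i' ti]|[i' ti]] := tP i; have [[j' tj]|[j' tj]] := tP j;
      rewrite ti tj.
    - by apply: le_lt_trans (contract_close u01 u01 (sP i' j' l)) _;
      rewrite subrr normr0 addr0.
    - by apply: le_lt_trans (contract_close u01 u'01 (sP i' j' l)) _; lra.
    - by apply: le_lt_trans (contract_close u'01 u01 (sP i' j' l)) _;
      rewrite distrC; lra.
    - by apply: le_lt_trans (contract_close u'01 u'01 (sP i' j' l)) _;
      rewrite subrr normr0 addr0.
  suff: forall n, (n <= N)%N -> exists2 e : chains m.+1 (simplex R k),
      supported (@small eta k m.+1) e &
      free_bdry e = free_fun (tuple_map (contract (n%:R / N%:R))) c - c.
    move=> /(_ N (leqnn N))[e eP eE]; exists e => //; rewrite eE; congr (_ - _).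
    apply: eq_free_fun => s; apply/ffunP => i; rewrite !tuple_mapE.
    apply/val_inj; rewrite divff ?gt_eqF// contractE ?ler01 ?lexx//.
    by rewrite subrr scale0r scale1r add0r.
  elim=> [_|n IH nN].
    exists 0; first exact: supported0.
    rewrite linear0 free_fun_tuple_id ?subrr// => q; apply/val_inj.
    by rewrite mul0r contractE ?ler01 ?lexx// subr0 scale1r scale0r addr0.
  have [e eP eE] := IH (ltnW nN).
  have u01 j : (j <= N)%N -> 0 <= (j%:R / N%:R : R) <= 1.
    by move=> jN; rewrite divr_ge0//= ler_pdivrMr// mul1r ler_nat.
  have [|e' e'P e'E] := step _ _ (u01 _ (ltnW nN)) (u01 _ nN).
    rewrite -mulrBl -natr1 opprD addrA subrr sub0r mulN1r normrN.
    by rewrite ger0_norm// invr_ge0 ltW.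
  exists (e + e'); first exact: supportedD.
  by rewrite linearD /= eE e'E addrC addrA subrK.
have sb m (c : chains m (simplex R k)) :
    supported (@tuples_in _ [set b] m) (free_fun (tuple_map (fun=> b)) c).
  apply: (supported_lift (@supported_dom _ _ c)) => s _; apply: supportedU => i.
  by rewrite tuple_mapE.
(* The contracted cycle need not vanish: it consists of constant tuples at [b]. It bounds among the
   tuples of this single point, all of which are small. *)
have [_ ac0 acS] := @tuples_in_acyclic K _ [set b] (ex_intro _ b erefl).
split.
- by exists [ffun=> b] => i j l; rewrite !ffunE subrr normr0.
- move=> c cP c0; have [e eP eE] := main _ _ cP erefl.
  have [|e' e'P e'E] := ac0 _ (sb _ c); first by rewrite aug_free_fun.
  exists (e' - e); first by apply: supportedB => //; exact: supportedS e'P.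
  by rewrite linearB /= eE e'E opprB addrC subrK.
move=> m c cP c0; have [e eP eE] := main _ _ cP c0.
have [|e' e'P e'E] := acS _ _ (sb _ c);
  first by rewrite -[LHS]free_funP c0 linear0.
exists (e' - e); first by apply: supportedB => //; exact: supportedS e'P.
by rewrite linearB /= eE e'E opprB addrC subrK.
Qed.

End SmallTuples.

Section Subdivision.
Variables (K : fieldType) (R : realType).
Local Notation chains m Z := {freeg (tuples Z m) / K}.

Lemma cell_bdry_vertices k :
  cell_bdry K (@vertices R k.+1) = cofaces << vertices k >>.
Proof.
apply: eq_bigr => i _; congr (_ *: _).
by rewrite face_vertices /free_fun fglift1.
Qed.

Lemma supported_cofaces eta k m (c : chains m (simplex R k)) : 0 < eta ->
  supported (@small _ eta k m) c -> supported (@small _ eta k.+1 m) (cofaces c).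
Proof.
move=> eta0 cP; apply: supported_sum => i _ _; apply: supportedZ.
rewrite /free_fun; apply: (@supported_lift K _ _ _ _ _ _ cP) => s sP.
by apply: supportedU; exact: small_coface.
Qed.

(* Each [s k.+1] fills the cycle formed by the images of [s k] in the faces of
   the simplex; this replaces iterated barycentric subdivision. *)
Theorem subdivision_exists (eta : R) : 0 < eta ->
  exists s : forall k, chains k (simplex R k),
  [/\ s 0 = << vertices 0 >>,
      forall k, supported (@small _ eta k k) (s k) &
      forall k, free_bdry (s k.+1) = cofaces (s k)].
Proof.
move=> eta0.
pose s := fix s k : chains k (simplex R k) := match k with
  | 0 => << vertices 0 >>
  | k'.+1 => xget 0 [set c : chains k'.+1 (simplex R k'.+1) |
      supported (@small _ eta k'.+1 k'.+1) c /\ free_bdry c = cofaces (s k')]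
  end.
have s0P : supported (@small _ eta 0 0) (s 0).
  by apply: supportedU => i j l; rewrite !ffunE !ord1 subrr normr0.
suff sP k : supported (@small _ eta k k) (s k) /\
    (supported (@small _ eta k.+1 k.+1) (s k.+1) /\
     free_bdry (s k.+1) = cofaces (s k)).
  by exists s; split=> // k; [exact: (sP k).1|exact: (sP k).2.2].
elim: k => [|k [sk [sk1 sE]]].
  split=> //; have [_ ac0 _] := small_acyclic K 1 eta0.
  have [||e eP eE] := ac0 (cofaces (s 0)).
  - exact: supported_cofaces.
  - exact: aug_cofaces0.
  by apply: xget_and; exists e.
split=> //; have [_ _ acS] := small_acyclic K k.+2 eta0.
have [||e eP eE] := acS k (cofaces (s k.+1)).
- exact: supported_cofaces.
- by rewrite bdry_cofaces sE cofacesK.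
by apply: xget_and; exists e.
Qed.

(** Nothing has to be small here, so each cycle is filled by a cone from a vertex of the whole
    simplex. [t 0] is 0 since a point is not subdivided. *)
Theorem subdivision_homotopy (s : forall k, chains k (simplex R k)) :
  s 0 = << vertices 0 >> -> (forall k, free_bdry (s k.+1) = cofaces (s k)) ->
  exists t : forall k, chains k.+1 (simplex R k), t 0 = 0 /\
  forall k, free_bdry (t k.+1) = s k.+1 - << vertices k.+1 >> - cofaces (t k).
Proof.
move=> s0 sE.
pose t := fix t k : chains k.+1 (simplex R k) := match k with
  | 0 => 0
  | k'.+1 => cone (vertex ord0 : simplex R k'.+1)
      (s k'.+1 - << vertices k'.+1 >> - cofaces (t k'))
  end.
have tE k : free_bdry (s k.+1 - << vertices k.+1 >> - cofaces (t k)) = 0 ->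
    free_bdry (t k.+1) = s k.+1 - << vertices k.+1 >> - cofaces (t k).
  by move=> x0; rewrite {1}/t -/t bdry_cone x0 linear0; exact: subr0.
suff t0 k : free_bdry (s k.+1 - << vertices k.+1 >> - cofaces (t k)) = 0.
  by exists t; split=> // k; exact: tE.
elim: k => [|k /tE IH].
  by rewrite 2!linearB /= sE free_bdryU cell_bdry_vertices s0 /t !linear0 addr0
    subrr.
rewrite 2!linearB /= sE free_bdryU cell_bdry_vertices bdry_cofaces IH.
rewrite [X in _ - X]linearB [X in _ - (X - _)]linearB /=.
by rewrite cofacesK subr0 subrr.
Qed.

End Subdivision.

Section NaturalFamily.
Variables (K : fieldType) (R : realType) (A B : semisimplicial).
Variable phi : forall k, A k -> semisimplicial_map (tuples (simplex R k)) B.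
Hypothesis phi_face : forall k i (a : A k.+1) m (p : tuples (simplex R k) m),
  phi (face i a) m p = phi a m (tuple_map (coface i) m p).
Local Notation chains m Z := {freeg (tuples Z m) / K}.

Lemma free_fun_cofaces k (a : A k.+1) m (c : chains m (simplex R k)) :
  free_fun (phi a) (cofaces c) =
  \sum_(i < k.+2) (-1) ^+ i *: free_fun (phi (face i a)) c.
Proof.
rewrite linear_sum; apply: eq_bigr => i _; rewrite linearZ /=; congr (_ *: _).
apply: (@eq_supported K _ _ setT
  (@free_fun K _ _ (phi a) m \o @free_fun K _ _ (tuple_map (coface i)) m)
  (@free_fun K _ _ (phi (face i a)) m)) => //= s _.
by rewrite /free_fun !fglift1 phi_face.
Qed.

Variable s : forall k, chains k (simplex R k).
Hypothesis s0 : s 0 = << vertices 0 >>.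
Hypothesis sS : forall k, free_bdry (s k.+1) = cofaces (s k).

(** Instantiated three times below: with affine pieces of a singular simplex, with the values of a
    singular simplex, and with pairs of a point of a realization and a vertex. *)
Definition subdivide k (a : A k) : {freeg (B k) / K} := free_fun (phi a) (s k).

Lemma subdivide_chain_on A' : chain_on A' subdivide.
Proof.
move=> k a _; rewrite /subdivide -free_funP [free_bdry _]sS /= free_fun_cofaces.
rewrite /cell_bdry linear_sum; apply: eq_bigr => i _.
by rewrite linearZ /= fglift1.
Qed.

Lemma subdivide_aug_on A' : aug_on A' subdivide.
Proof. by move=> a _; rewrite /subdivide s0 /free_fun fglift1 augU. Qed.

Lemma subdivide_homologous k (c : {freeg (A k) / K}) : free_bdry c = 0 ->
  exists e : {freeg (B k.+1) / K}, free_bdry e =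
    fglift (@subdivide k) c - fglift (fun a => << phi a k (vertices k) >>) c.
Proof.
move=> c0; have [t [t0 tS]] := subdivision_homotopy s0 sS.
exists (fglift (fun a => free_fun (phi a) (t k)) c).
have bt m (a : A m) : free_bdry (free_fun (phi a) (t m)) = free_fun (phi a)
  (free_bdry (t m)).
  exact: esym (free_funP _ _).
case: k c c0 => [|k] c c0.
  apply: (@eq_supported K _ _ setT
    (@free_bdry K B 1 \o fglift (fun a => free_fun (phi a) (t 0)))
    (fglift (@subdivide 0) \- fglift (fun a =>
      << phi a 0 (vertices 0) >>))) => //= a _.
  by rewrite !fglift1 bt t0 !linear0 /subdivide s0 /free_fun fglift1 subrr.
transitivity (fglift (@subdivide k.+1) c -
  fglift (fun a => << phi a k.+1 (vertices k.+1) >>) c -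
  fglift (fun a => free_fun (phi a) (t k)) (free_bdry c)).
  apply: (@eq_supported K _ _ setT
    (@free_bdry K B k.+2 \o fglift (fun a => free_fun (phi a) (t k.+1)))
    (fglift (@subdivide k.+1) \- fglift (fun a =>
      << phi a k.+1 (vertices k.+1) >>) \-
     (fglift (fun a => free_fun (phi a) (t k)) \o @free_bdry K A k.+1))) =>
       //= a _.
  rewrite !fglift1 bt tS free_bdryU !linearB /= free_fun_cofaces.
  congr (_ - _ - _); first by rewrite /free_fun fglift1.
  rewrite /cell_bdry linear_sum; apply: eq_bigr => i _.
  by rewrite linearZ /= fglift1.
by rewrite [free_bdry c]c0 linear0 subr0.
Qed.

End NaturalFamily.

Section Averages.
Variable R : realType.

(** The weights sum to 1, so one of them is positive, and that one makes the inequality strict. *)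
Lemma average_lt k (t : simplex R k) (f : 'I_k.+1 -> R) r :
  (forall i, val t 0 i != 0 -> f i < r) -> \sum_i val t 0 i * f i < r.
Proof.
move=> fr; have [i ti] : exists i, val t 0 i != 0.
  apply/existsP; apply: contraT; rewrite negb_exists => /forallP t0.
  have := simplex_sum1 t; rewrite big1; first by move/eqP;
    rewrite eq_sym oner_eq0.
  by move=> i _; have := t0 i; rewrite negbK => /eqP.
have -> : r = \sum_i val t 0 i * r by rewrite -mulr_suml simplex_sum1 mul1r.
have tf j : val t 0 j * f j <= val t 0 j * r.
  have [->|tj] := eqVneq (val t 0 j) 0; first by rewrite !mul0r.
  by apply: ler_wpM2l; [exact: simplex_ge0|exact/ltW/fr].
rewrite (bigD1 i)//= [ltRHS](bigD1 i)//=; apply: ltr_leD; last exact: ler_sum.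
by rewrite ltr_pM2l ?fr// lt_neqAle eq_sym ti simplex_ge0.
Qed.

End Averages.

(** * Nearest points in Euclidean space *)

Section Euclidean.
Variables (R : realType) (n : nat).
Implicit Types (x y z : 'rV[R]_n) (r : R).

Definition enorm x : R := Num.sqrt (\sum_i x 0 i ^+ 2).

Lemma eucl_distE x y : eucl_dist x y = enorm (x - y).
Proof. by congr Num.sqrt; apply: eq_bigr => i _; rewrite !mxE. Qed.

Lemma enorm_ge0 x : 0 <= enorm x. Proof. exact: sqrtr_ge0. Qed.

Lemma sqr_enorm x : enorm x ^+ 2 = \sum_i x 0 i ^+ 2.
Proof. by rewrite sqr_sqrtr// sumr_ge0// => i _; exact: sqr_ge0. Qed.

Lemma enormZ a x : enorm (a *: x) = `|a| * enorm x.
Proof.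
rewrite /enorm -sqrtr_sqr -sqrtrM ?sqr_ge0// mulr_sumr; congr Num.sqrt.
by apply: eq_bigr => i _; rewrite mxE exprMn.
Qed.

Lemma coord_enorm x i : `|x 0 i| <= enorm x.
Proof.
rewrite -(@ler_pXn2r _ 2)// ?nnegrE ?enorm_ge0// sqr_enorm real_normK
  ?num_real//.
by rewrite (bigD1 i)//= lerDl sumr_ge0// => j _; exact: sqr_ge0.
Qed.

Definition dot x y : R := \sum_i x 0 i * y 0 i.

Lemma sqr_enormD x y : enorm (x + y) ^+ 2 = enorm x ^+ 2 + 2 * dot x y + enorm
  y ^+ 2.
Proof.
rewrite !sqr_enorm mulr_sumr -!big_split; apply: eq_bigr => i _ /=.
by rewrite mxE sqrrD mulr_natl.
Qed.

Lemma dotZr a x y : dot x (a *: y) = a * dot x y.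
Proof. by rewrite mulr_sumr; apply: eq_bigr => i _; rewrite mxE mulrCA. Qed.

Lemma enorm0_eq0 x : enorm x = 0 -> x = 0.
Proof.
move=> x0; apply/rowP => i; apply/eqP; rewrite mxE -normr_le0 -x0.
exact: coord_enorm.
Qed.

(** Cauchy-Schwarz, from the square of the norm of [enorm y *: x - enorm x *: y]. *)
Lemma dot_le x y : dot x y <= enorm x * enorm y.
Proof.
have [/eqP/enorm0_eq0->|y0] := boolP (enorm y == 0).
  rewrite /dot big1 ?mulr_ge0 ?enorm_ge0// => i _; first by rewrite mxE mulr0.
have [/eqP/enorm0_eq0->|x0] := boolP (enorm x == 0).
  rewrite /dot big1 ?mulr_ge0 ?enorm_ge0// => i _; first by rewrite mxE mul0r.
have xp : 0 < enorm x by rewrite lt_neqAle eq_sym x0 enorm_ge0.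
have yp : 0 < enorm y by rewrite lt_neqAle eq_sym y0 enorm_ge0.
have := sqr_ge0 (enorm (enorm y *: x + (- enorm x) *: y)).
rewrite sqr_enormD !enormZ dotZr normrN !(ger0_norm (enorm_ge0 _)).
have -> : dot (enorm y *: x) y = enorm y * dot x y.
  by rewrite mulr_sumr; apply: eq_bigr => i _; rewrite mxE mulrA.
set a := enorm x in xp *; set b := enorm y in yp *; set d := dot x y.
have -> : (b * a) ^+ 2 + 2 * (- a * (b * d)) + (a * b) ^+ 2 =
  (2 * (a * b)) * (a * b - d) by ring.
by rewrite pmulr_rge0 ?subr_ge0//; rewrite mulr_gt0// mulr_gt0.
Qed.

Lemma ler_enormD x y : enorm (x + y) <= enorm x + enorm y.
Proof.
rewrite -(@ler_pXn2r _ 2)// ?nnegrE ?addr_ge0 ?enorm_ge0//.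
rewrite sqr_enormD sqrrD lerD2r lerD2l mulr_natl lerMn2r; exact: dot_le.
Qed.

Lemma enormN x : enorm (- x) = enorm x.
Proof. by rewrite -scaleN1r enormZ normrN normr1 mul1r. Qed.

Lemma enorm0 : enorm 0 = 0 :> R.
Proof. by rewrite -(scale0r (0 : 'rV_n)) enormZ normr0 mul0r. Qed.

Lemma eucl_dist_ge0 x y : 0 <= eucl_dist x y. Proof. exact: sqrtr_ge0. Qed.

Lemma eucl_distC x y : eucl_dist x y = eucl_dist y x.
Proof. by rewrite !eucl_distE -enormN opprB. Qed.

Lemma eucl_distxx x : eucl_dist x x = 0.
Proof. by rewrite eucl_distE subrr enorm0. Qed.

Lemma eucl_dist_triangle y x z : eucl_dist x z <= eucl_dist x y + eucl_dist y z.
Proof. by rewrite !eucl_distE; apply: le_trans (ler_enormD _ _);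
  rewrite addrA subrK. Qed.

Lemma enorm_bary k (t : simplex R k) (p : 'I_k.+1 -> 'rV[R]_n) :
  enorm (bary t p) <= \sum_i val t 0 i * enorm (p i).
Proof.
rewrite /bary; elim/big_ind2: _ => [|a b c d ab cd|i _];
  first by rewrite enorm0.
  by apply: le_trans (ler_enormD _ _) _; exact: lerD.
by rewrite enormZ ger0_norm ?simplex_ge0.
Qed.

Lemma bary_sub k (t : simplex R k) (p : 'I_k.+1 -> 'rV[R]_n) y :
  bary t p - y = bary t (fun i => p i - y).
Proof. by rewrite -[y in LHS](bary_const t) -sumrB; apply: eq_bigr => i _;
  rewrite scalerBr. Qed.

Lemma bary_dist_lt k (t : simplex R k) (p : 'I_k.+1 -> 'rV[R]_n) y r :
  (forall i, val t 0 i != 0 -> eucl_dist (p i) y < r) -> eucl_dist (bary t p) y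
    < r.
Proof.
move=> h; rewrite eucl_distE bary_sub; apply: le_lt_trans (enorm_bary _ _) _.
by apply: average_lt => i /h; rewrite eucl_distE.
Qed.

(* The weighted mean of [|p i - y|^2] exceeds that of [|p i - bary t p|^2] by
   [|bary t p - y|^2]. *)
Lemma bary_near_vertex k (t : simplex R k) (p : 'I_k.+1 -> 'rV[R]_n) y r :
  (forall i, eucl_dist (p i) y < r) ->
  exists2 i, val t 0 i != 0 & eucl_dist (bary t p) (p i) < r.
Proof.
move=> h; apply: contrapT => nex.
have r0 : 0 <= r by exact: le_trans (eucl_dist_ge0 _ _) (ltW (h ord0)).
pose b := bary t p.
have far i : val t 0 i != 0 -> r <= eucl_dist b (p i).
  by move=> ti; rewrite leNgt; apply/negP => hi; apply: nex; exists i.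
have : \sum_i val t 0 i * eucl_dist (p i) y ^+ 2 < r ^+ 2.
  apply: average_lt => i _; rewrite ltr_pXn2r ?nnegrE ?eucl_dist_ge0//.
apply/negP; rewrite -leNgt.
have -> : \sum_i val t 0 i * eucl_dist (p i) y ^+ 2 =
    \sum_i val t 0 i * (eucl_dist b (p i) ^+ 2) + enorm (b - y) ^+ 2.
  have E i : eucl_dist (p i) y ^+ 2 = eucl_dist b (p i) ^+ 2 +
      2 * dot (p i - b) (b - y) + enorm (b - y) ^+ 2.
    by rewrite eucl_distC [eucl_dist b _]eucl_distC !eucl_distE -sqr_enormD
      addrA subrK -enormN opprB.
  under eq_bigr do rewrite E 2!mulrDr.
  rewrite !big_split /= -mulr_suml simplex_sum1 mul1r; congr (_ + _).
  rewrite -[RHS]addr0; congr (_ + _).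
  under eq_bigr do rewrite mulrCA.
  rewrite -mulr_sumr; apply/eqP; rewrite mulf_eq0; apply/orP; right; apply/eqP.
  (* The cross terms vanish on average, the weighted mean of [p i - b] being 0. *)
  transitivity (dot (bary t p - b) (b - y)); last first.
    by rewrite /b subrr /dot big1// => i _; rewrite mxE mul0r.
  rewrite (bary_sub t p b) /dot; under eq_bigr do rewrite mulr_sumr.
  rewrite exchange_big; apply: eq_bigr => j _ /=.
  rewrite /bary summxE mulr_suml; apply: eq_bigr => i _.
  by rewrite [in RHS]mxE mulrA.
rewrite ler_wpDr ?sqr_ge0//.
have {1}-> : r ^+ 2 = \sum_i val t 0 i * r ^+ 2 by rewrite -mulr_suml
  simplex_sum1 mul1r.
apply: ler_sum => i _; have [->|ti] := eqVneq (val t 0 i) 0;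
  first by rewrite !mul0r.
apply: ler_wpM2l; first exact: simplex_ge0.
by rewrite ler_pXn2r ?nnegrE ?eucl_dist_ge0 ?far.
Qed.

Lemma eucl_ball_nbhs x r : 0 < r -> nbhs x (eucl_ball x r).
Proof.
move=> r0; have n0 : 0 < n.+1%:R :> R by rewrite ltr0n.
(* The Euclidean norm is at most the sum of the [n] absolute coordinates; [n.+1] keeps this sum
   strictly below [r] and covers dimension 0. *)
have e0 : 0 < r / n.+1%:R by rewrite divr_gt0.
apply/nbhs_ballP; exists (r / n.+1%:R) => //= y xy.
rewrite /eucl_ball /= eucl_distE.
have le : enorm (x - y) <= \sum_i `|(x - y) 0 i|.
  rewrite -(@ler_pXn2r _ 2)// ?nnegrE ?enorm_ge0 ?sumr_ge0// sqr_enorm.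
  rewrite expr2 mulr_suml; apply: ler_sum => i _.
  rewrite -real_normK ?num_real// expr2; apply: ler_wpM2l => //.
  by rewrite (bigD1 i)//= lerDl sumr_ge0.
apply: le_lt_trans le _.
apply: (@le_lt_trans _ _ (\sum_(i < n) (r / n.+1%:R))).
  apply: ler_sum => i _; rewrite !mxE; apply: ltW.
  by have [_ /(_ 0 i)] := xy; rewrite /ball /=.
rewrite sumr_const card_ord -[ltLHS]mulr_natr -mulrA gtr_pMr//.
by rewrite mulrC ltr_pdivrMr// mul1r ltr_nat.
Qed.

Lemma eucl_dist_continuous y : continuous (eucl_dist y).
Proof.
move=> x A /nbhs_ballP[e /= e0 eA].
apply: filterS (eucl_ball_nbhs x e0) => z xz; apply: eA.
rewrite /ball /= ltr_norml; move: xz; rewrite /eucl_ball /= => xz.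
have := eucl_dist_triangle x y z; have := eucl_dist_triangle z y x.
by rewrite (eucl_distC z x); lra.
Qed.

End Euclidean.

Section NearestPoint.
Variables (R : realType) (n : nat).
Implicit Types (x y z : 'rV[R]_n) (A B X : set 'rV[R]_n).

Definition is_nearest X y x :=
  X x /\ forall z, X z -> eucl_dist y x <= eucl_dist y z.

Lemma nearest_exists X y : compact X -> X !=set0 -> exists x, is_nearest X y x.
Proof.
move=> cX X0; have [|x xX xmin] := @compact_EVT_min _ R (eucl_dist y) X X0 cX.
  exact/continuous_subspaceT/eucl_dist_continuous.
by exists x; split=> [|z zX]; [exact/set_mem|exact/xmin/mem_set].
Qed.

Lemma dist_to_le y X x : X x -> dist_to y X <= eucl_dist y x.
Proof.
move=> Xx; apply: ge_inf; last by exists x.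
by exists 0 => _ [z _ <-]; exact: eucl_dist_ge0.
Qed.

Lemma dist_to_nearest y X x : is_nearest X y x -> dist_to y X = eucl_dist y x.
Proof.
move=> [Xx xmin]; apply/eqP; rewrite eq_le dist_to_le//=.
by apply: lb_le_inf => [|_ [z Xz <-]]; [exists (eucl_dist y x);
  exists x|exact: xmin].
Qed.

Lemma sup_dist_to_le A B a : compact A -> compact B -> B !=set0 -> A a ->
  exists2 b, B b & eucl_dist a b <= sup [set dist_to a B | a in A].
Proof.
move=> cA cB B0 Aa; have [b bB] := nearest_exists a cB B0.
exists b; first exact: bB.1.
rewrite -(dist_to_nearest bB); apply: ub_le_sup; last by exists a.
have [|c _ cmax] := @compact_EVT_max _ R (eucl_dist b) A (ex_intro _ a Aa) cA.
  exact/continuous_subspaceT/eucl_dist_continuous.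
exists (eucl_dist b c) => _ [a' Aa' <-].
apply: le_trans (dist_to_le _ bB.1) _; rewrite eucl_distC.
exact/cmax/mem_set.
Qed.

Lemma hausdorff_dist_l A B a : compact A -> compact B -> B !=set0 -> A a ->
  exists2 b, B b & eucl_dist a b <= hausdorff_dist A B.
Proof.
move=> cA cB B0 Aa; have [b Bb ab] := sup_dist_to_le cA cB B0 Aa.
by exists b => //; rewrite le_max ab.
Qed.

Lemma hausdorff_dist_r A B b : compact A -> compact B -> A !=set0 -> B b ->
  exists2 a, A a & eucl_dist b a <= hausdorff_dist A B.
Proof.
move=> cA cB A0 Bb; have [a Aa ab] := sup_dist_to_le cB cA A0 Bb.
by exists a => //; rewrite le_max ab orbT.
Qed.

Definition nearest X y := xget y (is_nearest X y).

Lemma nearestP X y : compact X -> X !=set0 -> is_nearest X y (nearest X y).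
Proof. by move=> cX X0; have [x] := nearest_exists y cX X0; exact: xgetI. Qed.

(** Otherwise [y] is in the medial axis, and its distance to [X], at most [eucl_dist y x], is at
    least the reach. *)
Lemma reach_nearest_unique X y x : X x -> ((eucl_dist y x)%:E < reach X)%E ->
  exists! x, is_nearest X y x.
Proof.
move=> Xx yr; apply: contrapT => nu; move: yr; apply/negP; rewrite -leNgt.
apply: (@le_trans _ _ (dist_to y X)%:E); last by rewrite lee_fin dist_to_le.
by apply: ereal_inf_lbound; exists y.
Qed.

Lemma nearest_unique X y x : compact X -> (exists! x, is_nearest X y x) ->
  is_nearest X y x -> nearest X y = x.
Proof.
move=> cX [x0 [_ u]] xn.
have yn : is_nearest X y (nearest X y) by apply: nearestP => //; exists x;
  exact: xn.1.
by rewrite -(u _ yn) -(u _ xn).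
Qed.

Lemma nearest_id X x : compact X -> X x -> nearest X x = x.
Proof.
move=> cX Xx; have [Xy ymin] := nearestP x cX (ex_intro _ x Xx).
have := ymin _ Xx; rewrite eucl_distxx eucl_distE => d0.
apply/esym/eqP; rewrite -subr_eq0; apply/eqP/enorm0_eq0/eqP.
by rewrite eq_le d0 enorm_ge0.
Qed.

(* A nearest point of [y'] lying outside a neighbourhood of [nearest X y] is at
   distance from [y] larger than the minimum by a fixed gap. *)
Lemma nearest_continuous X y : compact X -> (exists! x, is_nearest X y x) ->
  {for y, continuous (nearest X)}.
Proof.
move=> cX uX; have [x0 [x0n x0u]] := uX.
have X0 : X !=set0 by exists x0; exact: x0n.1.
rewrite /prop_for /continuous_at (nearest_unique cX uX x0n) => U.
rewrite nbhsE => -[V [oV Vx0] VU].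
pose C := X `&` ~` V.
have cC : compact C.
  by apply: compact_closedI => //; rewrite closedC.
have [C0|/set0P C0] := eqVneq C set0.
  apply: (@filterS _ (nbhs y) (nbhs_filter y) setT); last exact: filterT.
  move=> y' _; apply: VU; apply: contrapT => nV.
  suff : C (nearest X y') by rewrite C0.
  by split=> //; exact: (nearestP y' cX X0).1.
have [x1 [[Xx1 nVx1] x1min]] := nearest_exists y cC C0.
have gap : eucl_dist y x0 < eucl_dist y x1.
  rewrite ltNge; apply/negP => le10; apply: nVx1.
  suff <- : x0 = x1 by [].
  by apply: x0u; split=> // z Xz; apply: le_trans le10 _; exact: x0n.2.
(* Half of the gap, because the displacement from [y] to [y'] is spent twice: on the distance to
   [x0] and on the distance to the nearest point of [y']. *)
have e0 : 0 < (eucl_dist y x1 - eucl_dist y x0) / 2 by rewrite divr_gt0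
  ?subr_gt0.
apply: filterS (eucl_ball_nbhs y e0) => y' yy'; apply: VU.
apply: contrapT => nV; have [Xn nmin] := nearestP y' cX X0.
have : C (nearest X y') by [].
move=> /x1min; have := nmin _ x0n.1; move: yy'; rewrite /eucl_ball /= => yy'.
have := eucl_dist_triangle y y' x0;
  have := eucl_dist_triangle y' y (nearest X y').
rewrite (eucl_distC y' y).
by lra.
Qed.

End NearestPoint.

(** Stated at a point, because continuity of the projection is known only at points closer to [X]
    than the reach. *)
Lemma continuous_at_initial (Y : choiceType) (X Z : topologicalType) (w : Y ->
  Z)
    (f : X -> initial_topology w) x :
  {for x, continuous (w \o f)} -> {for x, continuous f}.
Proof.
move=> cf U [?/= [[W oW <-]]] /= Wsfz /filterS; apply; apply: cf.
exact: open_nbhs_nbhs.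
Qed.

Section Projection.
Variables (R : realType) (n : nat) (X : set 'rV[R]_n).
Hypotheses (X_compact : compact X) (X_neq0 : X !=set0).

Lemma nproj_subproof y : nearest X y \in X.
Proof. exact/mem_set/(nearestP y X_compact X_neq0).1. Qed.

Definition nproj y : set_type X := exist _ (nearest X y) (nproj_subproof y).

Lemma nproj_val (x : set_type X) : nproj (val x) = x.
Proof. by apply/val_inj; rewrite /= nearest_id//; case: x => x /= /set_mem. Qed.

Lemma nproj_continuous y x : X x -> ((eucl_dist y x)%:E < reach X)%E ->
  {for y, continuous nproj}.
Proof.
move=> Xx yx; apply: (@continuous_at_initial _ _ _ set_val).
exact: nearest_continuous X_compact (reach_nearest_unique Xx yx).
Qed.

Lemma nproj_dist y x : X x -> eucl_dist y (val (nproj y)) <= eucl_dist y x.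
Proof. exact: (nearestP y X_compact X_neq0).2. Qed.

End Projection.

Section Continuity.
Variable R : realType.

Lemma coord_simplex_continuous k (i : 'I_k.+1) :
  continuous (fun t : simplex R k => val t 0 i).
Proof.
move=> t; apply: (@continuous_comp _ _ _ set_val (fun v : 'rV[R]_k.+1 =>
  v 0 i)).
  exact: initial_continuous.
exact: coord_continuous.
Qed.

Lemma bary_continuous (M : normedModType R) k (p : 'I_k.+1 -> M) :
  continuous (fun t : simplex R k => bary t p).
Proof.
have -> : (fun t : simplex R k => bary t p) =
    \sum_i (fun t : simplex R k => val t 0 i *: p i).
  by apply/funext => t; rewrite fct_sumE.
move=> t; elim/big_ind: _ => [|f g cf cg|i _]; first exact: cst_continuous.
  exact: continuousD.
by apply: continuousZr_tmp; exact: coord_simplex_continuous.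
Qed.

Lemma sbary_continuous k m (p : 'I_m.+1 -> simplex R k) :
  continuous (fun t : simplex R m => sbary t p).
Proof.
apply: (@continuous_comp_initial _ _ _ set_val) => t.
exact: (@bary_continuous _ m (fun i => val (p i))).
Qed.

Lemma std_simplex_compact k : compact (@std_simplex R k).
Proof.
apply: (@subclosed_compact _ _ [set v : 'rV[R]_k.+1 | forall i,
  v ord0 i \in `[0, 1]]).
- have -> : @std_simplex R k =
      (\bigcap_(i in [set: 'I_k.+1])
        (fun v : 'rV[R]_k.+1 => v 0 i) @^-1` [set x | 0 <= x]) `&`
      (fun v : 'rV[R]_k.+1 => \sum_i v 0 i) @^-1` [set 1].
    apply/seteqP; split=> v [v0 v1]; split=> // i; first by move=> _; exact: v0.
    exact: (v0 i I).
  apply: closedI.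
    apply: closed_bigI => i _.
    apply: preimage_closed; last exact: (@closed_ge R 0).
    by move=> v _; exact: coord_continuous.
  apply: preimage_closed; last exact: (@closed_eq R 1).
  move=> v _.
  have -> : (fun v : 'rV[R]_k.+1 =>
    \sum_i v 0 i) = \sum_i (fun v : 'rV[R]_k.+1 => v 0 i).
    by apply/funext => w; rewrite fct_sumE.
  elim/big_ind: _ => [|f g cf cg|i _]; first exact: cst_continuous.
    exact: continuousD.
  exact: coord_continuous.
- apply: (@rV_compact _ _ (fun=> `[0 : R, 1]%classic)) => _.
  exact: segment_compact.
move=> v [v0 v1] i /=; rewrite in_itv /= v0 -v1 (bigD1 i)//= lerDl.
by apply: sumr_ge0.
Qed.

(** The Heine-Cantor theorem, with the coordinatewise closeness that [small] uses. *)
Lemma simplex_uniform_continuous n k (f : simplex R k -> 'rV[R]_n) (e : R) :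
  continuous f -> 0 < e -> exists2 eta, 0 < eta &
  forall p q : simplex R k, (forall l, `|val p 0 l - val q 0 l| < eta) ->
    eucl_dist (f p) (f q) < e.
Proof.
move=> cf e0.
have local (p : simplex R k) : exists2 d, 0 < d & forall q : simplex R k,
    (forall l, `|val p 0 l - val q 0 l| < d) -> eucl_dist (f p) (f q) < e / 2.
  have e20 : 0 < e / 2 by rewrite divr_gt0.
  have := cf p _ (eucl_ball_nbhs (f p) e20).
  rewrite /nbhs /= => -[_ /= [[W oW <-]]] /= Wp WA.
  have /nbhs_ballP[d /= d0 dW] : nbhs (val p) W by exact: open_nbhs_nbhs.
  exists d => // q pq; apply: WA; apply: dW; split=> // i j.
  by rewrite ord1; exact: pq.
have := (@compact_near_coveringP _ (@std_simplex R k)).1 (@std_simplex_compact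
  k).
move=> /(_ R 0^'+ (fun eta x => forall p : simplex R k, val p = x ->
  forall q : simplex R k,   (forall l,
    `|val p 0 l - val q 0 l| < eta) -> eucl_dist (f p) (f q) < e)).
case.
  move=> x xK; pose p : simplex R k := exist _ x (mem_set xK).
  have [d d0 dP] := local p.
  have d20 : 0 < d / 2 by rewrite divr_gt0.
  (* Half of the local modulus goes to the distance from [p] to [p'], the other half to that from
     [p'] to [q]. *)
  exists (ball x (d / 2), [set eta | eta < d / 2]) => /=.
    split; first exact: nbhsx_ballx.
    exact: nbhs_right_lt.
  move=> [x' eta] [[_ xx'] etad] p' p'x q p'q.
  have xp' l : `|val p 0 l - val p' 0 l| < d / 2.
    by have := xx' 0 l; rewrite -p'x /ball /=.
  have pp' : eucl_dist (f p) (f p') < e / 2.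
    by apply: dP => l; apply: lt_trans (xp' l) _;
      rewrite ltr_pdivrMr// ltr_pMr// ltr1n.
  have pq : eucl_dist (f p) (f q) < e / 2.
    apply: dP => l; apply: le_lt_trans (ler_distD (val p' 0 l) _ _) _.
    by rewrite [ltRHS]splitr; apply: ltrD => //; exact: lt_trans (p'q l) etad.
  have := eucl_dist_triangle (f p) (f p') (f q).
  by rewrite eucl_distC in pp'; lra.
move=> d /= d0 dP; have d20 : 0 < d / 2 by rewrite divr_gt0.
exists (d / 2) => // p q; apply: (dP (d / 2) _ d20 (val p)) => //.
  by rewrite /= sub0r normrN gtr0_norm// ltr_pdivrMr// ltr_pMr// ltr1n.
by case: p => p /= /set_mem.
Qed.

End Continuity.

(** * Singular simplices *)

Section SingularSimplices.
Variables (R : realType) (T : topologicalType).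

(* [f] itself when it is continuous, and a constant otherwise. *)
Definition mk_simplex (x0 : T) k (f : simplex R k -> T) : singular_set R T k :=
  match pselect (continuous f) with
  | left cf => (mkcts cf : continuousType _ _)
  | right _ => (mkcts (@cst_continuous (simplex R k) T x0) : continuousType _ _)
  end.

Lemma mk_simplexE x0 k (f : simplex R k -> T) : continuous f ->
  (mk_simplex x0 f : continuousType _ _) =1 f.
Proof. by move=> cf t; rewrite /mk_simplex; case: pselect. Qed.

Lemma singularP k (s t : singular_set R T k) :
  (s : continuousType _ _) =1 (t : continuousType _ _) -> s = t.
Proof. by move=> st; apply/continuousEP. Qed.

Lemma singular_faceE k h (s : singular_set R T k.+1) t :
  (face h s : continuousType _ _) t = (s : continuousType _ _) (coface h t).
Proof. by []. Qed.

Lemma affine_continuous k (s : singular_set R T k) m (p : tuples (simplex R k)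
  m) :
  continuous (fun t : simplex R m => (s : continuousType _ _) (sbary t p)).
Proof.
move=> t; apply: continuous_comp; first exact: sbary_continuous.
exact: cts_fun.
Qed.

Definition affine_fun k (s : singular_set R T k) m (p : tuples (simplex R k) m)
  :
  singular_set R T m := (mkcts (@affine_continuous k s m p) : continuousType _
    _).

Lemma affine_face k (s : singular_set R T k) m h (p : tuples (simplex R k)
  m.+1) :
  affine_fun s (face h p) = face h (affine_fun s p).
Proof.
apply: singularP => t; rewrite singular_faceE /= /mkcts sbary_coface.
by congr ((s : continuousType _ _) _); congr sbary; apply/funext => i;
  rewrite tuple_faceE.
Qed.

Definition affine_map k (s : singular_set R T k) :
    semisimplicial_map (tuples (simplex R k)) (singular_set R T) :=
  SemiSimplicialMap (affine_face s).

Lemma affine_map_face k i (s : singular_set R T k.+1) m (p : tuples (simplex R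
  k) m) :
  affine_map (face i s) m p = affine_map s m (tuple_map (coface i) m p).
Proof.
apply: singularP => t /=; rewrite /mkcts coface_sbary.
by congr ((s : continuousType _ _) _); congr sbary; apply/funext => j;
  rewrite /= tuple_mapE.
Qed.

Lemma affine_map_vertices k (s : singular_set R T k) :
  affine_map s k (vertices k) = s.
Proof. by apply: singularP => t /=; rewrite /mkcts sbary_vertices. Qed.

Definition vertex_tuple_fun k (s : singular_set R T k) : tuples T k :=
  [ffun i => (s : continuousType _ _) (vertex i)].

Lemma vertex_tuple_face k h (s : singular_set R T k.+1) :
  vertex_tuple_fun (face h s) = face h (vertex_tuple_fun s).
Proof. by apply/ffunP => i;
  rewrite tuple_faceE !ffunE singular_faceE coface_vertex. Qed.

Definition vertex_tuple : semisimplicial_map (singular_set R T) (tuples T) :=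
  SemiSimplicialMap vertex_tuple_face.

End SingularSimplices.

Lemma chain_on_cells (K : fieldType) (A B : semisimplicial) (A' : cells A)
    (g : forall k, A k -> B k) :
  (forall k i (a : A k.+1), A' k.+1 a -> face i (g k.+1 a) = g k (face i a)) ->
  chain_on A' (fun k a => << g k a >> : {freeg (B k) / K}).
Proof.
move=> gf k a A'a; rewrite free_bdryU /cell_bdry linear_sum.
by apply: eq_bigr => i _; rewrite linearZ /= fglift1 gf.
Qed.

Section Nearby.
Variables (R : realType) (n : nat) (X : set 'rV[R]_n).
Hypotheses (X_compact : compact X) (X_neq0 : X !=set0).
Local Notation nproj := (nproj X_compact X_neq0).
Local Notation Sing := (singular_set R (set_type X)).

Definition near_set : set 'rV[R]_n :=
  [set y | exists2 x, X x & ((eucl_dist y x)%:E < reach X)%E].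

Lemma proj_comp_continuous (T : topologicalType) (f : T -> 'rV[R]_n) :
  continuous f -> (forall t, near_set (f t)) -> continuous (nproj \o f).
Proof.
move=> cf fn t; apply: continuous_comp; first exact: cf.
by have [x Xx xr] := fn t; exact: nproj_continuous Xx xr.
Qed.

Definition proj_simplex k (p : tuples 'rV[R]_n k) : Sing k :=
  mk_simplex (nproj 0) (fun t : simplex R k => nproj (bary t p)).

Definition near_tuples : cells (tuples 'rV[R]_n) :=
  fun k p => forall t : simplex R k, near_set (bary t p).

Lemma near_tuples_face_closed : face_closed near_tuples.
Proof.
move=> k h p pn t; have := pn (coface h t); rewrite bary_coface.
by congr (near_set (bary t _)); apply/funext => i; rewrite tuple_faceE.
Qed.

Lemma proj_simplex_continuous k (p : tuples 'rV[R]_n k) : near_tuples p ->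
  continuous (fun t : simplex R k => nproj (bary t p)).
Proof. by move=> pn; apply: proj_comp_continuous => //;
  exact: bary_continuous. Qed.

Lemma proj_simplexE k (p : tuples 'rV[R]_n k) t : near_tuples p ->
  (proj_simplex p : continuousType _ _) t = nproj (bary t p).
Proof. by move=> pn; rewrite mk_simplexE//; exact: proj_simplex_continuous. Qed.

Lemma face_proj_simplex k h (p : tuples 'rV[R]_n k.+1) : near_tuples p ->
  face h (proj_simplex p) = proj_simplex (face h p).
Proof.
move=> pn; apply: singularP => t.
rewrite singular_faceE !proj_simplexE//; last exact: near_tuples_face_closed.
rewrite bary_coface; congr (nproj (bary t _)).
by apply/funext => i; rewrite tuple_faceE.
Qed.

End Nearby.

(** * Straight-line homotopy from a singular chain to the projected simplices on its vertices *)

Section StraightLine.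
Variables (K : fieldType) (R : realType) (n : nat) (X : set 'rV[R]_n).
Hypotheses (X_compact : compact X) (X_neq0 : X !=set0).
Local Notation nproj := (nproj X_compact X_neq0).
Local Notation Sing := (singular_set R (set_type X)).
Local Notation ev s := (s : continuousType _ (set_type X)).
Variable delta : R.
Hypothesis delta_reach : (delta%:E <= reach X)%E.

Definition small_singular : cells Sing := fun k s =>
  forall t t' : simplex R k, eucl_dist (val (ev s t)) (val (ev s t')) < delta.

Lemma small_singular_face_closed : face_closed small_singular.
Proof. by move=> k h s sP t t'; rewrite !singular_faceE; exact: sP. Qed.

Definition vertex_points k (s : Sing k) : tuples 'rV[R]_n k :=
  tuple_map val k (vertex_tuple R (set_type X) k s).

Lemma vertex_pointsE k (s : Sing k) i : vertex_points s i = val (ev s (vertex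
  i)).
Proof. by rewrite tuple_mapE ffunE. Qed.

Lemma face_vertex_points k h (s : Sing k.+1) :
  vertex_points (face h s) = face h (vertex_points s).
Proof. by rewrite face_tuple_map /vertex_points cell_funP. Qed.

Definition line k (s : Sing k) (z : simplex R k * R) : 'rV[R]_n :=
  (1 - z.2) *: val (ev s z.1) + z.2 *: bary z.1 (vertex_points s).

(** Affine simplices in the product of a simplex with the time axis; composed with [line], they turn
    the combinatorial prism into singular simplices of the homotopy. *)
Definition zbary k m (t : simplex R m) (p : tuples (simplex R k * R)%type m) :
    simplex R k * R :=
  (sbary t (fun i => (p i).1), bary t (fun i => (p i).2 : R^o)).

Definition line_simplex k (s : Sing k) m (p : tuples (simplex R k * R)%type m)
  : Sing m :=
  mk_simplex (nproj 0) (fun t : simplex R m => nproj (line s (zbary t p))).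

Definition unit_tuples k : cells (tuples (simplex R k * R)%type) :=
  fun m p => forall i, 0 <= (p i).2 <= 1.

Lemma unit_tuples_face_closed k : face_closed (@unit_tuples k).
Proof. by move=> m h p pP i; rewrite tuple_faceE. Qed.

Lemma zbary_unit k m (t : simplex R m) (p : tuples (simplex R k * R)%type m) :
  unit_tuples p -> 0 <= (zbary t p).2 <= 1.
Proof.
move=> pP; rewrite /zbary /bary /=; apply/andP; split.
  by apply: sumr_ge0 => i _; apply: mulr_ge0;
    [exact: simplex_ge0|case/andP: (pP i)].
rewrite -(simplex_sum1 t); apply: ler_sum => i _.
by rewrite -[leRHS]mulr1; apply: ler_wpM2l;
  [exact: simplex_ge0|case/andP: (pP i)].
Qed.

(** All vertices of [s] are within [delta] of the value at [z.1], hence so are their barycentres and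
    the segments leading to them, and [delta] is at most the reach. *)
Lemma line_near k (s : Sing k) z : small_singular s -> 0 <= z.2 <= 1 ->
  near_set X (line s z).
Proof.
move=> sP /andP[z0 z1]; exists (val (ev s z.1));
  first by case: (ev s z.1) => x /= /set_mem.
apply: lt_le_trans delta_reach; rewrite lte_fin eucl_distE.
have -> : line s z - val (ev s z.1) =
    z.2 *: (bary z.1 (vertex_points s) - val (ev s z.1)).
  rewrite /line scalerBl scale1r scalerBr addrC addrA addrA addNr add0r.
  exact: addrC.
rewrite enormZ ger0_norm// -eucl_distE.
apply: (@le_lt_trans _ _ (eucl_dist (bary z.1 (vertex_points s)) (val (ev s
  z.1)))).
  by rewrite ler_piMl// eucl_dist_ge0.
by apply: bary_dist_lt => i _; rewrite vertex_pointsE.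
Qed.

Lemma line_simplex_continuous k (s : Sing k) m (p : tuples (simplex R k *
  R)%type m) :
  small_singular s -> unit_tuples p ->
  continuous (fun t : simplex R m => nproj (line s (zbary t p))).
Proof.
move=> sP pP; apply: proj_comp_continuous => [t|t];
  last exact: line_near sP (zbary_unit _ pP).
have cq : {for t, continuous (fun t : simplex R m => sbary t (fun i =>
  (p i).1))}.
  exact: sbary_continuous.
have cu : {for t, continuous (fun t : simplex R m => bary t (fun i =>
  (p i).2 : R^o))}.
  exact: bary_continuous.
pose q (t : simplex R m) := sbary t (fun i => (p i).1).
pose u (t : simplex R m) : R^o := bary t (fun i => (p i).2 : R^o).
apply: (@continuousD _ _ _ (fun t => (1 - u t) *: val (ev s (q t)))
  (fun t => u t *: bary (q t) (vertex_points s))); apply: continuousZ.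
- by apply: (@continuousB _ R^o); [exact: cst_continuous|exact: cu].
- apply: (@continuous_comp _ _ _ q (fun z => val (ev s z)) t cq).
  by apply: continuous_comp; [exact: cts_fun|exact: initial_continuous].
- exact: cu.
- apply: (@continuous_comp _ _ _ q (fun z => bary z (vertex_points s)) t cq).
  exact: bary_continuous.
Qed.

Lemma line_simplexE k (s : Sing k) m (p : tuples (simplex R k * R)%type m) t :
  small_singular s -> unit_tuples p ->
  ev (line_simplex s p) t = nproj (line s (zbary t p)).
Proof. by move=> sP pP; rewrite mk_simplexE//;
  exact: line_simplex_continuous. Qed.

Lemma face_line_simplex k (s : Sing k) m h (p : tuples (simplex R k * R)%type
  m.+1) :
  small_singular s -> unit_tuples p ->
  face h (line_simplex s p) = line_simplex s (face h p).
Proof.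
move=> sP pP; apply: singularP => t.
rewrite singular_faceE !line_simplexE//; last exact: unit_tuples_face_closed.
congr (nproj (line s _)); rewrite /zbary sbary_coface bary_coface.
by congr (sbary t _, bary t _); apply/funext => i; rewrite tuple_faceE.
Qed.

Definition coface_prod k (h : 'I_k.+2) (z : simplex R k * R) : simplex R k.+1 *
  R :=
  (coface h z.1, z.2).

Lemma line_simplex_face k h (s : Sing k.+1) m (p : tuples (simplex R k *
  R)%type m) :
  small_singular s -> unit_tuples p ->
  line_simplex (face h s) p = line_simplex s (tuple_map (coface_prod h) m p).
Proof.
move=> sP pP; apply: singularP => t.
rewrite !line_simplexE//; last 2 first.
- by move=> i; rewrite tuple_mapE; exact: pP.
- exact: small_singular_face_closed.
congr nproj.
have -> : zbary t (tuple_map (coface_prod h) m p) = coface_prod h (zbary t p).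
  rewrite /coface_prod /zbary /= coface_sbary.
  by congr (sbary t _, bary t _); apply/funext => i; rewrite /= tuple_mapE.
rewrite /line /= bary_coface face_vertex_points.
by congr (_ + _ *: bary _ _); apply/funext => i; rewrite tuple_faceE.
Qed.

Definition at0 k (q : simplex R k) : simplex R k * R := (q, 0).
Definition at1 k (q : simplex R k) : simplex R k * R := (q, 1).

Lemma line_simplex_at0 k (s : Sing k) : small_singular s ->
  line_simplex s (tuple_map (@at0 k) k (vertices k)) = s.
Proof.
move=> sP; apply: singularP => t; rewrite line_simplexE//; last first.
  by move=> i; rewrite tuple_mapE /= lexx ler01.
rewrite -[RHS](nproj_val X_compact X_neq0); congr nproj; rewrite /line.
have -> : zbary t (tuple_map (@at0 k) k (vertices k)) = (t, 0).
  rewrite /zbary; congr (_, _).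
    rewrite -[RHS]sbary_vertices; congr sbary; apply/funext => i.
    by rewrite tuple_mapE.
  by rewrite /bary big1// => i _; rewrite tuple_mapE /= scaler0.
by rewrite /= subr0 scale1r scale0r addr0.
Qed.

Lemma line_simplex_at1 k (s : Sing k) : small_singular s ->
  line_simplex s (tuple_map (@at1 k) k (vertices k)) =
  proj_simplex X_compact X_neq0 (vertex_points s).
Proof.
move=> sP; apply: singularP => t; rewrite line_simplexE//; last first.
  by move=> i; rewrite tuple_mapE /= lexx ler01.
have E : line s (zbary t (tuple_map (@at1 k) k (vertices k))) = bary t
  (vertex_points s).
  have -> : zbary t (tuple_map (@at1 k) k (vertices k)) = (t, 1).
    rewrite /zbary; congr (_, _).
      rewrite -[RHS]sbary_vertices; congr sbary; apply/funext => i.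
      by rewrite tuple_mapE.
    rewrite -[RHS](bary_const t (1 : R^o)); congr bary; apply/funext => i.
    by rewrite tuple_mapE.
  by rewrite /line /= subrr scale0r scale1r add0r.
rewrite E proj_simplexE// => u.
have -> : bary u (vertex_points s) = line s (u, 1).
  by rewrite /line /= subrr scale0r scale1r add0r.
by apply: line_near => //=; rewrite lexx ler01.
Qed.

Definition line_prism k (s : Sing k) : {freeg (Sing k.+1) / K} :=
  fglift (fun p => << line_simplex s p >>) (prism K (@at0 k) (@at1 k) (vertices
    k)).

Lemma unit_prism k m (p : tuples (simplex R k) m) :
  supported (@unit_tuples k m.+1) (prism K (@at0 k) (@at1 k) p).
Proof.
apply: (supportedS _ (@supported_prism K _ _ (@at0 k) (@at1 k) m p)) => q qP i.
by case: (qP i) => -[j ->] /=; rewrite lexx ler01.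
Qed.

Lemma bdry_line_prism k m (s : Sing k) (c : {freeg (tuples (simplex R k *
  R)%type m.+1) / K}) :
  small_singular s -> supported (@unit_tuples k m.+1) c ->
  free_bdry (fglift (fun p => << line_simplex s p >>) c) =
  fglift (fun p => << line_simplex s p >>) (free_bdry c) :> {freeg (Sing m) /
    K}.
Proof.
move=> sP cP.
apply: (@bdry_lift K _ _ (@unit_tuples k) (fun k p =>
  << line_simplex s p >>) m c) => //.
by apply: chain_on_cells => l i p pP; exact: face_line_simplex.
Qed.

Lemma line_chain_face k m i (s : Sing k.+1)
    (c : {freeg (tuples (simplex R k * R)%type m) / K}) :
  small_singular s -> supported (@unit_tuples k m) c ->
  fglift (fun p => << line_simplex s p >>) (free_fun (tuple_map (coface_prod
    i)) c) =
  fglift (fun p => << line_simplex (face i s) p >>) c :> {freeg (Sing m) / K}.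
Proof.
move=> sP cP; apply: (@eq_supported K _ _ (@unit_tuples k m)
  (fglift (fun p => << line_simplex s p >>) \o @free_fun K _ _ (tuple_map
    (coface_prod i)) m)
  (fglift (fun p => << line_simplex (face i s) p >>)) c cP).
by move=> p pP /=; rewrite /free_fun !fglift1 line_simplex_face.
Qed.

Lemma straight_line_homologous k (c : {freeg (Sing k) / K}) :
  supported (@small_singular k) c -> free_bdry c = 0 ->
  exists e : {freeg (Sing k.+1) / K}, free_bdry e =
    fglift (fun s => << proj_simplex X_compact X_neq0 (vertex_points s) >>) c -
      c.
Proof.
pose g m (s : Sing m) := proj_simplex X_compact X_neq0 (vertex_points s).
rewrite -/(g k) => cP c0; exists (fglift (@line_prism k) c).
case: k c cP c0 => [|k] c cP c0.
  apply: (@eq_supported K _ _ (@small_singular 0)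
    (@free_bdry K Sing 1 \o fglift (@line_prism 0))
    (fglift (fun s => << g 0 s >>) \- idfun)) => //= s sP.
  rewrite !fglift1 bdry_line_prism//; last exact: unit_prism.
  by rewrite bdry_prism0 linearB /= !fglift1 line_simplex_at0//
    line_simplex_at1.
transitivity (fglift (fun s =>
  << g k.+1 s >>) c - c - fglift (@line_prism k) (free_bdry c)).
  apply: (@eq_supported K _ _ (@small_singular k.+1)
    (@free_bdry K Sing k.+2 \o fglift (@line_prism k.+1))
    (fglift (fun s => << g k.+1 s >>) \- idfun \-
      (fglift (@line_prism k) \o @free_bdry K Sing k.+1))) => //= s sP.
  rewrite !fglift1 bdry_line_prism//; last exact: unit_prism.
  rewrite bdry_prism !linearB /= !fglift1 line_simplex_at0// line_simplex_at1//.
  congr (_ - _); rewrite free_bdryU /cell_bdry !linear_sum;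
    apply: eq_bigr => i _.
  rewrite !linearZ /= !fglift1; congr (_ *: _).
  (* The prism over the [i]-th face of the tautological tuple is the prism of the lower simplex
     pushed by [coface_prod i]; under [line_simplex] this becomes the prism of the face of [s]. *)
  rewrite face_vertices -(@free_fun_prism K _ _ _ _ (@at0 k) (@at1 k) _ _ _
    (coface_prod i))//.
  rewrite /line_prism.
  exact: (line_chain_face i sP (@unit_prism k k (vertices k))).
by rewrite [free_bdry c]c0 linear0 subr0.
Qed.

End StraightLine.

Lemma uniform_seq (R : realType) (T : eqType) (r : seq T) (P : R -> T -> Prop) :
  (forall x, x \in r -> exists2 eta, 0 < eta & P eta x) ->
  (forall eta eta' x, eta <= eta' -> P eta' x -> P eta x) ->
  exists2 eta, 0 < eta & forall x, x \in r -> P eta x.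
Proof.
move=> + mono; elim: r => [|x r IH] ex; first by exists 1.
have [eta eta0 etaP] := ex x (mem_head _ _).
have [|eta' eta'0 eta'P] := IH; first by move=> y yr; apply: ex;
  rewrite inE yr orbT.
exists (Num.min eta eta'); first by rewrite lt_min eta0.
move=> y; rewrite inE => /predU1P[->|/eta'P yP].
  by apply: mono etaP; rewrite ge_min lexx.
by apply: mono yP; rewrite ge_min lexx orbT.
Qed.

(** Intervals are convex, so averaging preserves the strict bound; this is applied to one endpoint
    and then to the other. *)
Lemma small_sbary (R : realType) (eta : R) k m (p : tuples (simplex R k) m)
    (t t' : simplex R m) l : small eta p ->
  `|val (sbary t p) 0 l - val (sbary t' p) 0 l| < eta.
Proof.
move=> pS.
have main (u : simplex R m) x : (forall i, `|val (p i) 0 l - x| < eta) ->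
    `|val (sbary u p) 0 l - x| < eta.
  move=> h; rewrite sbaryE.
  have -> : \sum_j val u 0 j * val (p j) 0 l - x = \sum_j val u 0 j * (val (p
    j) 0 l - x).
    under [RHS]eq_bigr do rewrite mulrBr.
    by rewrite sumrB -mulr_suml simplex_sum1 mul1r.
  apply: le_lt_trans (ler_norm_sum _ _ _) _.
  under eq_bigr do rewrite normrM ger0_norm ?simplex_ge0//.
  by apply: average_lt => i _.
by apply: (main t) => i; rewrite distrC; apply: (main t') => j; exact: pS.
Qed.

(** * Comparison of the singular and Cech complexes *)

Section Comparison.
Variables (K : fieldType) (R : realType) (n : nat) (X S : set 'rV[R]_n).
Hypotheses (X_compact : compact X) (X_neq0 : X !=set0).
Variables (alpha alpha' eps delta : R).
Hypotheses (delta_gt0 : 0 < delta) (eps_ge0 : 0 <= eps).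
Hypothesis near_S : forall x, X x -> exists2 s, S s & eucl_dist x s <= eps.
Hypothesis near_X : forall s, S s -> exists2 x, X x & eucl_dist s x <= eps.
Hypothesis le_alpha : delta + eps <= alpha.
Hypothesis le_alpha' : delta + alpha + 2 * eps <= alpha'.
Hypothesis lt_reach : ((alpha' + eps)%:E < reach X)%E.
Local Notation nproj := (nproj X_compact X_neq0).
Local Notation Sing := (singular_set R (set_type X)).
Local Notation ev s := (s : continuousType _ (set_type X)).
Local Notation proj_simplex := (proj_simplex X_compact X_neq0).
Local Notation chains m Z := {freeg (tuples Z m) / K}.
Local Notation Cech r := (ordered_set (cech S r)).

Lemma near_of_dist y x : X x -> eucl_dist y x <= alpha' + eps -> near_set X y.
Proof.
move=> Xx yx; exists x => //; apply: le_lt_trans lt_reach.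
by rewrite lee_fin.
Qed.

Lemma delta_le_reach : (delta%:E <= reach X)%E.
Proof.
apply: le_trans (ltW lt_reach); rewrite lee_fin.
by move: eps_ge0 le_alpha le_alpha' delta_gt0; lra.
Qed.

Definition points r k (s : Cech r k) : tuples 'rV[R]_n k := val s.

Lemma points_face r k h (s : Cech r k.+1) : points (face h s) = face h (points
  s).
Proof. by []. Qed.

Lemma pointsP r k (s : Cech r k) : (forall i, S (points s i)) /\
  exists y, forall i, eucl_dist (points s i) y < r.
Proof.
have [_ sS [y sy]] := ordered_simplexP s; split=> [i|].
  by apply: sS; apply/imfsetP; exists i.
by exists y => i; apply: sy; apply/imfsetP; exists i.
Qed.

Lemma cech_imfset r k (f : 'I_k.+1 -> lexi_rV R n) y : (forall i, S (f i)) ->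
  (forall i, eucl_dist (f i) y < r) -> cech_set S r [fset f i | i in
    'I_k.+1]%fset.
Proof.
move=> fS fy; split.
- by apply/fset0Pn; exists (f ord0); apply/imfsetP; exists ord0.
- by move=> _ /imfsetP[i _ ->].
by exists y => _ /imfsetP[i _ ->] /=; exact: fy.
Qed.

Lemma points_near r k (s : Cech r k) : r <= alpha' -> near_tuples X (points s).
Proof.
move=> r_alpha' t; have [sS [y sy]] := pointsP s.
have [i _ bi] := bary_near_vertex t sy.
have [x Xx ix] := near_X (sS i).
apply: (near_of_dist Xx); apply: le_trans (eucl_dist_triangle (points s i) _ _)
  _.
by apply: lerD ix; exact: le_trans (ltW bi) r_alpha'.
Qed.

Definition realize_fun r k (s : Cech r k) : Sing k := proj_simplex (points s).

Lemma realize_face r (r_alpha' : r <= alpha') k h (s : Cech r k.+1) :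
  realize_fun (face h s) = face h (realize_fun s).
Proof. by rewrite /realize_fun face_proj_simplex//; exact: points_near. Qed.

Definition realize r (r_alpha' : r <= alpha') : semisimplicial_map (Cech r)
  Sing :=
  SemiSimplicialMap (realize_face r_alpha').

Definition sample x : 'rV[R]_n := xget 0 [set s | S s /\ eucl_dist x s <= eps].

Lemma sampleP x : X x -> S (sample x) /\ eucl_dist x (sample x) <= eps.
Proof.
by move=> /near_S[s Ss xs];
  exact: (@xgetI _ 0 [set s | S s /\ eucl_dist x s <= eps] s).
Qed.

Definition rips : cells (tuples 'rV[R]_n) := fun k x =>
  (forall i, X (x i)) /\ forall i j, eucl_dist (x i) (x j) < delta.

Lemma rips_face_closed : face_closed rips.
Proof. by move=> k h x [xX xd]; split=> [i|i j]; rewrite !tuple_faceE. Qed.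

Definition sample_fset k (x : tuples 'rV[R]_n k) : {fset lexi_rV R n} :=
  [fset (sample (x i) : lexi_rV R n) | i in 'I_k.+1]%fset.

(** The first point of the tuple is a common point of the balls: each sample is within [eps] of its
    own point, which is within [delta] of the first. *)
Lemma sample_fset_cech k (x : tuples 'rV[R]_n k) : rips x ->
  cech_set S alpha (sample_fset x).
Proof.
move=> [xX xd]; apply: (@cech_imfset _ _ _ (x ord0)) => i.
  exact: (sampleP (xX i)).1.
apply: lt_le_trans le_alpha;
  apply: le_lt_trans (eucl_dist_triangle (x i) _ _) _.
by rewrite eucl_distC addrC; apply: ltr_leD (xd i ord0) (sampleP (xX i)).2.
Qed.

Lemma sample_fset_face k h (x : tuples 'rV[R]_n k.+1) v :
  v \in sample_fset (face h x) -> v \in sample_fset x.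
Proof.
by move=> /imfsetP[i _ ->]; rewrite tuple_faceE; apply/imfsetP;
  exists (lift h i).
Qed.

Lemma sample_chain_exists : exists psi : forall k, tuples 'rV[R]_n k ->
    {freeg (Cech alpha k) / K},
  [/\ chain_on rips psi, aug_on rips psi &
    carried rips (fun k x => full_simplex (C :=
      cech S alpha) (sample_fset x)) psi].
Proof.
apply: carrier_existence.
- exact: rips_face_closed.
- by move=> k x xP; apply: full_simplex_acyclic; exact: sample_fset_cech.
- by move=> k i x xP m s sF j; exact: sample_fset_face (sF j).
Qed.

Definition points_map r : semisimplicial_map (Cech r) (tuples 'rV[R]_n) :=
  SemiSimplicialMap (@points_face r).

Lemma near_tuples_of_dist k (p : tuples 'rV[R]_n k) x : X x ->
  (forall i, eucl_dist (p i) x < delta + eps) -> near_tuples X p.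
Proof.
move=> Xx px t; apply: (near_of_dist Xx); apply: ltW.
apply: lt_le_trans (bary_dist_lt _) _; first by move=> i _; exact: px.
by move: eps_ge0 le_alpha' le_alpha delta_gt0; lra.
Qed.

Lemma proj_simplex_chain_on :
  chain_on (near_tuples X) (fun k p =>
    << proj_simplex p >> : {freeg (Sing k) / K}).
Proof. by apply: chain_on_cells => k i p pn; rewrite face_proj_simplex. Qed.

Section Sample.
Variable psi : forall k, tuples 'rV[R]_n k -> {freeg (Cech alpha k) / K}.
Hypothesis psi_chain : chain_on rips psi.
Hypothesis psi_aug : aug_on rips psi.
Hypothesis psi_carried :
  carried rips (fun k x => full_simplex (C :=
    cech S alpha) (sample_fset x)) psi.

(** Carrier of a tuple: all tuples made of its points and their samples. These are within
    [delta + eps] of the first point, so the filling consists of near tuples and can still be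
    projected to [X]. *)
Lemma sample_homologous k (z : chains k 'rV[R]_n) :
  supported (@rips k) z -> free_bdry z = 0 ->
  exists2 e : chains k.+1 'rV[R]_n, supported (@near_tuples _ _ X k.+1) e &
    free_bdry e = z - free_fun (points_map alpha) (fglift (psi (k := k)) z).
Proof.
move=> zR z0.
pose near_x k (x : tuples 'rV[R]_n k) : set 'rV[R]_n :=
  [set y | (exists i, y = x i) \/ (exists i, y = sample (x i))].
pose P k (x : tuples 'rV[R]_n k) : cells (tuples 'rV[R]_n) :=
  tuples_in (near_x k x).
pose f k (x : tuples 'rV[R]_n k) : chains k 'rV[R]_n :=
  free_fun (points_map alpha) (psi x).
pose g k (x : tuples 'rV[R]_n k) : chains k 'rV[R]_n := << x >>.
have E (c : chains k 'rV[R]_n) :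
    fglift (@g k) c - fglift (@f k) c = c - free_fun (points_map alpha) (fglift
      (psi (k := k)) c).
  apply: (@eq_supported K _ _ setT (fglift (@g k) \- fglift (@f k))
    (idfun \- (@free_fun K _ _ (points_map alpha) k \o fglift (psi (k :=
      k))))) => //= x _.
  by rewrite !fglift1.
rewrite -E; apply: (@carrier_homologous K _ _ rips rips_face_closed P) => //.
- by move=> l x xR; apply: tuples_in_acyclic; exists (x ord0); left;
  exists ord0.
- move=> l i x xR m s sP j; case: (sP j) => -[i' ->]; rewrite tuple_faceE.
    by left; exists (lift i i').
  by right; exists (lift i i').
- move=> l x xR; rewrite /f -(free_funP (points_map alpha) (psi x)) [free_bdry
  _]psi_chain//=.
  apply: (@eq_supported K _ _ setT (@free_fun K _ _ (points_map alpha) l \o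
    fglift (psi (k := l)))
    (fglift (@f l))) => //= y _.
  by rewrite !fglift1.
- by apply: chain_on_cells.
- by move=> x xR; rewrite /f aug_free_fun psi_aug.
- by move=> x xR; exact: augU.
- move=> l x xR; apply: (@supported_lift K _ _ _ _ _ _ (psi_carried xR)) =>
  s sF.
  apply: supportedU => i; right; have /imfsetP[j _ sj] := sF i.
  by exists j.
- by move=> l x xR; apply: supportedU => i; left; exists i.
move=> x [xX xd] p pP; apply: (near_tuples_of_dist (xX ord0)) => i.
case: (pP i) => -[j ->].
  by apply: lt_le_trans (xd j ord0) _; rewrite lerDl.
apply: le_lt_trans (eucl_dist_triangle (x j) _ _) _.
by rewrite eucl_distC addrC; apply: ltr_leD (xd j ord0) (sampleP (xX j)).2.
Qed.

Definition modulus eta : cells Sing := fun k s => forall p q : simplex R k,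
  (forall l, `|val p 0 l - val q 0 l| < eta) ->
  eucl_dist (val (ev s p)) (val (ev s q)) < delta.

Lemma modulus_face_closed eta : 0 < eta -> face_closed (modulus eta).
Proof.
move=> eta0 k h s sP p q pq; rewrite !singular_faceE; apply: sP => l.
by rewrite !mxE; case: unlift => [j|] /=; [exact: pq|rewrite subrr normr0].
Qed.

Lemma common_modulus k (r : seq (Sing k)) :
  exists2 eta, 0 < eta & forall s, s \in r -> modulus eta s.
Proof.
apply: uniform_seq => [s _|eta eta' s le sP p q pq]; last first.
  by apply: sP => l; exact: lt_le_trans (pq l) le.
have cs : continuous (fun p : simplex R k => val (ev s p)).
  move=> p; apply: continuous_comp; first exact: cts_fun.
  exact: initial_continuous.
exact: simplex_uniform_continuous cs delta_gt0.
Qed.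

Definition singular_points k (s : Sing k) :
    semisimplicial_map (tuples (simplex R k)) (tuples 'rV[R]_n) :=
  tuple_map (fun p => val (ev s p)).

Lemma singular_points_face k i (s : Sing k.+1) m (p : tuples (simplex R k) m) :
  singular_points (face i s) m p = singular_points s m (tuple_map (coface i) m
    p).
Proof. by apply/ffunP => j; rewrite !tuple_mapE singular_faceE. Qed.

Section Subdivided.
Variables (eta : R) (s : forall k, chains k (simplex R k)).
Hypothesis eta_gt0 : 0 < eta.
Hypothesis s0 : s 0 = << vertices 0 >>.
Hypothesis s_small : forall k, supported (@small _ eta k k) (s k).
Hypothesis sS : forall k, free_bdry (s k.+1) = cofaces (s k).

Definition subdivided_points k (z : {freeg (Sing k) / K}) : chains k 'rV[R]_n :=
  fglift (subdivide singular_points s (k := k)) z.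

Lemma bdry_subdivided_points k (z : {freeg (Sing k.+1) / K}) :
  free_bdry (subdivided_points z) = subdivided_points (free_bdry z).
Proof.
apply: (@bdry_lift K _ _ (fun k =>
  setT) (subdivide singular_points s) k z) => //.
exact: (@subdivide_chain_on K R _ _ _ singular_points_face s sS).
Qed.

Lemma subdivided_points_cycle k (z : {freeg (Sing k) / K}) : free_bdry z = 0 ->
  free_bdry (subdivided_points z) = 0.
Proof.
case: k z => // k z z0.
by rewrite bdry_subdivided_points [free_bdry z]z0 /subdivided_points linear0.
Qed.

Lemma subdivided_points_rips k (z : {freeg (Sing k) / K}) :
  supported (@modulus eta k) z -> supported (@rips k) (subdivided_points z).
Proof.
move=> zM; apply: (@supported_lift K _ _ _ _ _ _ zM) => t tM.
apply: (@supported_lift K _ _ _ _ _ _ (@s_small k)) => p pS; apply: supportedU.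
split=> [i|i j]; rewrite !tuple_mapE; last by apply: tM => l; exact: pS.
by case: (ev t (p i)) => x /= /set_mem.
Qed.

(** Two homologies are added: from [z] to its subdivision, then from the subdivision, now
    [delta]-small, to the projected simplices on its vertices. *)
Lemma singular_homologous k (z : {freeg (Sing k) / K}) :
  supported (@modulus eta k) z -> free_bdry z = 0 ->
  exists e : {freeg (Sing k.+1) / K}, free_bdry e =
    fglift (fun p => << proj_simplex p >>) (subdivided_points z) - z.
Proof.
move=> zM z0.
pose aff k (t : Sing k) := affine_map t.
pose z' : {freeg (Sing k) / K} := fglift (subdivide aff s (k := k)) z.
have aff_chain := @subdivide_chain_on K R Sing Sing aff (@affine_map_face _ _)
  s sS.
have [e1 e1E] : exists e : {freeg (Sing k.+1) / K}, free_bdry e = z' - z.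
  have [e eE] := subdivide_homologous (@affine_map_face R (set_type X)) s0 sS
    z0.
  exists e; rewrite eE; congr (_ - _).
  apply: (@eq_supported K _ _ setT
    (fglift (fun t => << affine_map t k (vertices k) >>)) idfun) => //= t _.
  by rewrite fglift1 affine_map_vertices.
have z'0 : free_bdry z' = 0.
  exact: (@bdry_lift_cycle K _ _ (fun k => setT) _ k z (aff_chain _)).
have z'S : supported (@small_singular _ _ X delta k) z'.
  apply: (@supported_lift K _ _ _ _ _ _ zM) => t tM.
  apply: (@supported_lift K _ _ _ _ _ _ (@s_small k)) => p pS;
    apply: supportedU.
  by move=> u u'; apply: tM => l; exact: small_sbary.
have [e2 e2E] := straight_line_homologous X_compact X_neq0 delta_le_reach z'S
  z'0.
exists (e1 + e2); rewrite linearD /= e1E e2E addrC addrA subrK; congr (_ - _).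
rewrite /z' /subdivided_points.
apply: (@eq_supported K _ _ setT
  (fglift (fun t => << proj_simplex (vertex_points t) >>) \o fglift (subdivide
    aff s (k := k)))
  (fglift (fun p => << proj_simplex p >>) \o
    fglift (subdivide singular_points s (k := k)))) => // t _ /=.
rewrite !fglift1 /subdivide.
apply: (@eq_supported K _ _ setT
  (fglift (fun t => << proj_simplex (vertex_points t) >>) \o @free_fun K _ _
    (aff k t) k)
  (fglift (fun p => << proj_simplex p >>) \o
    @free_fun K _ _ (singular_points t) k)) => // p _ /=.
rewrite /free_fun !fglift1; congr << proj_simplex _ >>.
apply/ffunP => i; rewrite vertex_pointsE tuple_mapE /= /mkcts.
by congr (val (ev t _)); apply/val_inj; rewrite /= bary_vertex.
Qed.

End Subdivided.

(** The class is hit by the sampled subdivision: [e1] joins [z] to the projected simplices on the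
    subdivided points, and the filling [e2] between these points and their samples lies in near
    tuples, so it projects to [X]. *)
Lemma realize_surjective (le_alpha_alpha' : alpha <= alpha') k (z : {freeg
  (Sing k) / K}) :
  free_bdry z = 0 -> exists2 c : {freeg (Cech alpha k) / K}, free_bdry c = 0 &
  exists e : {freeg (Sing k.+1) / K},
    free_bdry e = z - free_fun (realize le_alpha_alpha') c.
Proof.
move=> z0; have [eta eta0 zM] := common_modulus (dom z).
have [s [s0 s_small sS]] := subdivision_exists K eta0.
pose u := subdivided_points s z.
have uR : supported (@rips k) u by apply: subdivided_points_rips s_small _ _ zM.
have u0 : free_bdry u = 0 by exact: subdivided_points_cycle.
exists (fglift (psi (k := k)) u); first exact: bdry_lift_cycle psi_chain uR u0.
have [e1 e1E] := singular_homologous s0 s_small sS zM z0.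
have [e2 e2N e2E] := sample_homologous uR u0.
exists (- e1 + fglift (fun p => << proj_simplex p >>) e2).
rewrite linearD linearN /= e1E (bdry_lift proj_simplex_chain_on e2N) e2E.
rewrite opprB [fglift _ (_ - _)]linearB /= addrA subrK; congr (_ - _).
apply: (@eq_supported K _ _ setT
  (fglift (fun p => << proj_simplex p >>) \o @free_fun K _ _ (points_map alpha)
    k)
  (@free_fun K _ _ (realize le_alpha_alpha') k)) => // p _ /=.
by rewrite /free_fun !fglift1.
Qed.

(** * Injectivity: chains of pairs *)

Section Injectivity.
Hypothesis alpha_alpha' : alpha <= alpha'.

Definition cech_incl : semisimplicial_map (Cech alpha) (Cech alpha') :=
  SemiSimplicialMap (incl_funP (@cech_subset _ _ S _ _ alpha_alpha')).

Lemma cech_setI r (F : {fset lexi_rV R n}) y : F != fset0 ->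
  (forall v, v \in F -> S v /\ eucl_dist v y < r) -> cech_set S r F.
Proof. by move=> F0 FP; split=> // [v /FP[]//|]; exists y => v /FP[]. Qed.

(* Only the vertices of nonzero weight are allowed, so that the choice commutes
   with cofaces. *)
Definition support_vertex k (s : Cech alpha k) (p : simplex R k) : 'rV[R]_n :=
  xget 0 [set v | (exists2 i, val p 0 i != 0 & v = points s i) /\
                  eucl_dist (bary p (points s)) v < alpha].

Lemma support_vertexP k (s : Cech alpha k) (p : simplex R k) :
  (exists i, support_vertex s p = points s i) /\
  eucl_dist (bary p (points s)) (support_vertex s p) < alpha.
Proof.
have [sS [y sy]] := pointsP s; have [i pi bi] := bary_near_vertex p sy.
have [] := @xgetI _ 0 [set v | (exists2 i, val p 0 i != 0 & v = points s i) /\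
  eucl_dist (bary p (points s)) v < alpha] (points s i).
  by split=> //; exists i.
by move=> [j _ vj] vd; split=> //; exists j.
Qed.

Lemma bary_points_face k h (s : Cech alpha k.+1) (p : simplex R k) :
  bary p (points (face h s)) = bary (coface h p) (points s).
Proof.
rewrite bary_coface points_face; congr bary; apply/funext => i.
by rewrite tuple_faceE.
Qed.

Lemma support_vertex_face k h (s : Cech alpha k.+1) (p : simplex R k) :
  support_vertex (face h s) p = support_vertex s (coface h p).
Proof.
rewrite /support_vertex bary_points_face; congr xget; apply/seteqP.
split=> v [[i pi vi] vd]; split=> //.
  exists (lift h i); first by rewrite /= mxE liftK.
  by rewrite vi points_face tuple_faceE.
move: pi; rewrite /= mxE; case: unliftP => [j ij|_] /=; last by rewrite eqxx.
by move=> pj; exists j => //; rewrite vi points_face tuple_faceE ij.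
Qed.

Local Notation pairs := ('rV[R]_n * 'rV[R]_n)%type.

(* A pair keeps track of a point [y] of the realization of a simplex and of one
   of its vertices: forgetting [y] gives a map homotopic to the inclusion, while
   sampling the foot of [y] on [X] gives the map that factors through [X]. *)
Definition pair_map k (s : Cech alpha k) :
    semisimplicial_map (tuples (simplex R k)) (tuples pairs) :=
  tuple_map (fun p => (bary p (points s), support_vertex s p)).

Lemma pair_map_face k i (s : Cech alpha k.+1) m (p : tuples (simplex R k) m) :
  pair_map (face i s) m p = pair_map s m (tuple_map (coface i) m p).
Proof.
apply/ffunP => j; rewrite !tuple_mapE support_vertex_face.
by rewrite bary_points_face.
Qed.

Definition foot (z : pairs) : 'rV[R]_n := val (nproj z.1).

(** Closeness of the first components gives the balls a common point; closeness of the feet, which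
    does not follow from it by a fixed constant here, makes the foot tuples admissible for [psi]. *)
Definition small_pairs : cells (tuples pairs) := fun k m =>
  [/\ forall i, S (m i).2, forall i, eucl_dist (m i).1 (m i).2 < alpha,
      forall i j, eucl_dist (m i).1 (m j).1 < delta &
      forall i j, eucl_dist (foot (m i)) (foot (m j)) < delta].

Lemma small_pairs_face_closed : face_closed small_pairs.
Proof.
by move=> k h m [mS m1 m2 m3]; split=> [i|i|i j|i j]; rewrite !tuple_faceE.
Qed.

Lemma foot_rips k (m : tuples pairs k) : small_pairs m -> rips (tuple_map foot
  k m).
Proof.
move=> [_ _ _ md]; split=> [i|i j]; rewrite !tuple_mapE; last exact: md.
by rewrite /foot; case: (nproj (m i).1) => x /= /set_mem.
Qed.

Definition second_fset k (m : tuples pairs k) : {fset lexi_rV R n} :=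
  [fset ((m i).2 : lexi_rV R n) | i in 'I_k.+1]%fset.

Definition both_fset k (m : tuples pairs k) : {fset lexi_rV R n} :=
  (second_fset m `|` sample_fset (tuple_map foot k m))%fset.

Lemma second_fset_neq0 k (m : tuples pairs k) : second_fset m != fset0.
Proof. by apply/fset0Pn; exists (m ord0).2; apply/imfsetP; exists ord0. Qed.

(** The common point is [(m ord0).1]. A sample is within [eps] of its foot, the foot within
    [alpha + eps] of [(m i).1], and that within [delta] of the common point: exactly the sum bounded
    in [le_alpha']. *)
Lemma both_fset_cech k (m : tuples pairs k) : small_pairs m ->
  cech_set S alpha' (both_fset m).
Proof.
move=> mP; have [mS m1 m2 m3] := mP; have [footX _] := foot_rips mP.
apply: (@cech_setI _ _ (m ord0).1).
  have /fset0Pn[v vF] := second_fset_neq0 m.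
  by apply/fset0Pn; exists v; rewrite inE vF.
move=> v; rewrite inE => /orP[] /imfsetP[i _ ->].
  split; first exact: mS.
  apply: le_lt_trans (eucl_dist_triangle (m i).1 _ _) _.
  have d1 := m1 i; have d2 := m2 i ord0; rewrite eucl_distC in d1.
  by move: (ltrD d1 d2) eps_ge0 le_alpha'; lra.
have [sS sd] := sampleP (footX i); split => //; rewrite tuple_mapE in sS sd *.
have [x Xx vx] := near_X (mS i).
have d1 : eucl_dist (m i).1 (foot (m i)) < alpha + eps.
  apply: le_lt_trans (nproj_dist X_compact X_neq0 _ Xx) _.
  apply: le_lt_trans (eucl_dist_triangle (m i).2 _ _) _.
  by apply: ltr_leD => //; exact: m1.
have d2 := m2 i ord0.
apply: le_lt_trans (eucl_dist_triangle (foot (m i)) _ _) _.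
have d3 := eucl_dist_triangle (m i).1 (foot (m i)) (m ord0).1.
rewrite eucl_distC; rewrite (eucl_distC (foot _) (m i).1) in d3.
move: sd d1 d2 d3 le_alpha'.
set a := eucl_dist _ _; set b := eucl_dist _ _; set c := eucl_dist _ _.
by set d := eucl_dist _ _; lra.
Qed.

Lemma second_fset_face k h (m : tuples pairs k.+1) v :
  v \in second_fset (face h m) -> v \in second_fset m.
Proof.
by move=> /imfsetP[i _ ->]; rewrite tuple_faceE; apply/imfsetP;
  exists (lift h i).
Qed.

Lemma both_fset_face k h (m : tuples pairs k.+1) v :
  v \in both_fset (face h m) -> v \in both_fset m.
Proof.
rewrite !inE => /orP[/second_fset_face->//|].
by rewrite -face_tuple_map => /sample_fset_face ->; rewrite orbT.
Qed.

Lemma second_fset_cech k (m : tuples pairs k) : small_pairs m ->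
  cech_set S alpha' (second_fset m).
Proof.
move=> /both_fset_cech mP; apply: (cech_set_sub mP);
  last exact: second_fset_neq0.
by apply/fsubsetP => v vF; rewrite inE vF.
Qed.

Lemma second_chain_exists : exists psi1 : forall k, tuples pairs k ->
    {freeg (Cech alpha' k) / K},
  [/\ chain_on small_pairs psi1, aug_on small_pairs psi1 &
    carried small_pairs
      (fun k m => full_simplex (C := cech S alpha') (second_fset m)) psi1].
Proof.
apply: carrier_existence.
- exact: small_pairs_face_closed.
- by move=> k m mP; apply: full_simplex_acyclic; exact: second_fset_cech.
- by move=> k i m mP l s sF j; exact: second_fset_face (sF j).
Qed.

Section Second.
Variable psi1 : forall k, tuples pairs k -> {freeg (Cech alpha' k) / K}.
Hypothesis psi1_chain : chain_on small_pairs psi1.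
Hypothesis psi1_aug : aug_on small_pairs psi1.
Hypothesis psi1_carried : carried small_pairs
  (fun k m => full_simplex (C := cech S alpha') (second_fset m)) psi1.

(** Sampling the feet and keeping the vertices are both carried by the simplex on [both_fset], which
    exists at scale [alpha']. *)
Lemma second_homologous k (y : chains k pairs) :
  supported (@small_pairs k) y -> free_bdry y = 0 ->
  exists e : {freeg (Cech alpha' k.+1) / K}, free_bdry e =
    free_fun cech_incl (fglift (psi (k := k)) (free_fun (tuple_map foot) y)) -
    fglift (psi1 (k := k)) y.
Proof.
move=> yP y0.
pose P k (m : tuples pairs k) : cells (Cech alpha') :=
  full_simplex (C := cech S alpha') (both_fset m).
pose g k (m : tuples pairs k) : {freeg (Cech alpha' k) / K} :=
  free_fun cech_incl (psi (tuple_map foot k m)).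
have E l (c : chains l pairs) : fglift (@g l) c =
    free_fun cech_incl (fglift (psi (k := l)) (free_fun (tuple_map foot) c)).
  apply: (@eq_supported K _ _ setT (fglift (@g l)) (@free_fun K _ _ cech_incl l
    \o
    (fglift (psi (k := l)) \o @free_fun K _ _ (tuple_map foot) l))) => //= m _.
  by rewrite /free_fun !fglift1.
rewrite -E.
suff [e _ eE] : exists2 e : {freeg (Cech alpha' k.+1) / K}, supported setT e &
    free_bdry e = fglift (@g k) y - fglift (@psi1 k) y by exists e.
apply: (@carrier_homologous K _ _ small_pairs small_pairs_face_closed P) => //.
- by move=> l m mP; apply: full_simplex_acyclic; exact: both_fset_cech.
- by move=> l i m mP j s sF i'; exact: both_fset_face (sF i').
- move=> l m mP; rewrite /g -(free_funP cech_incl (psi _)) [free_bdry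
  _]psi_chain//=; last first.
    exact: foot_rips.
  rewrite E /=; congr (free_fun _ (fglift _ _)).
  transitivity (free_bdry (free_fun (tuple_map foot) << m >> : chains l.+1
    'rV[R]_n)).
    by rewrite /free_fun fglift1 free_bdryU.
  by rewrite -(free_funP (tuple_map foot)) free_bdryU.
- by move=> m mP; rewrite /g aug_free_fun psi_aug//; exact: foot_rips.
- move=> l m mP; apply: (@supportedS _ _ _ _ _ _ (psi1_carried mP)) => s sF i.
  by rewrite inE sF.
- move=> l m mP; apply: (@supported_lift K _ _ _ _ _ _ (psi_carried (foot_rips
  mP))) => s sF.
  by apply: supportedU => i; rewrite inE [_ \in sample_fset _](sF i) orbT.
Qed.

End Second.

Section SubdividedPairs.
Variables (eta : R) (s : forall k, chains k (simplex R k)).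
Hypothesis eta_gt0 : 0 < eta.
Hypothesis s0 : s 0 = << vertices 0 >>.
Hypothesis s_small : forall k, supported (@small _ eta k k) (s k).
Hypothesis sS : forall k, free_bdry (s k.+1) = cofaces (s k).

Definition cech_modulus : cells (Cech alpha) := fun k t =>
  modulus eta (realize_fun t) /\ forall p q : simplex R k,
    (forall l, `|val p 0 l - val q 0 l| < eta) ->
    eucl_dist (bary p (points t)) (bary q (points t)) < delta.

Lemma cech_modulus_face_closed : face_closed cech_modulus.
Proof.
move=> k h t [tM tP]; split.
  by rewrite (realize_face alpha_alpha'); exact: modulus_face_closed.
move=> p q pq; rewrite !bary_points_face; apply: tP => l.
by rewrite !mxE; case: unlift => [j|] /=; [exact: pq|rewrite subrr normr0].
Qed.

Lemma foot_pair_map k (t : Cech alpha k) (p : simplex R k) :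
  foot (bary p (points t), support_vertex t p) = val (ev (realize_fun t) p).
Proof. by rewrite proj_simplexE//; exact: points_near. Qed.

(** The second clause serves the carrier argument for the inclusion: it keeps the image of [t] under
    [psi1] among the vertices of [t]. *)
Lemma subdivide_pairs_supported k (t : Cech alpha k) : cech_modulus t ->
  supported [set m : tuples pairs k | small_pairs m /\
    forall i, exists j, (m i).2 = points t j] (subdivide pair_map s t).
Proof.
move=> [tM tP]; apply: (@supported_lift K _ _ _ _ _ _ (@s_small k)) => p pS.
apply: supportedU; split; last first.
  by move=> i; rewrite tuple_mapE; exact: (support_vertexP t (p i)).1.
have [tS _] := pointsP t.
split=> [i|i|i j|i j]; rewrite !tuple_mapE.
- by have [[j ->] _] := support_vertexP t (p i); exact: tS.
- exact: (support_vertexP t (p i)).2.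
- by apply: tP => l; exact: pS.
by rewrite !foot_pair_map; apply: tM => l; exact: pS.
Qed.

Variable psi1 : forall k, tuples pairs k -> {freeg (Cech alpha' k) / K}.
Hypothesis psi1_chain : chain_on small_pairs psi1.
Hypothesis psi1_aug : aug_on small_pairs psi1.
Hypothesis psi1_carried : carried small_pairs
  (fun k m => full_simplex (C := cech S alpha') (second_fset m)) psi1.

Definition points_fset k (t : Cech alpha k) : {fset lexi_rV R n} :=
  [fset (points t i : lexi_rV R n) | i in 'I_k.+1]%fset.

(** Both chain maps send [t] into the full simplex on the vertices of [t] itself, which is
    acyclic. *)
Lemma incl_homologous k (c : {freeg (Cech alpha k) / K}) :
  supported (@cech_modulus k) c -> free_bdry c = 0 ->
  exists e : {freeg (Cech alpha' k.+1) / K}, free_bdry e =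
    free_fun cech_incl c -
    fglift (psi1 (k := k)) (fglift (subdivide pair_map s (k := k)) c).
Proof.
move=> cM c0.
pose P k (t : Cech alpha k) : cells (Cech alpha') :=
  full_simplex (C := cech S alpha') (points_fset t).
pose f k (t : Cech alpha k) : {freeg (Cech alpha' k) / K} :=
  fglift (psi1 (k := k)) (subdivide pair_map s t).
pose g k (t : Cech alpha k) : {freeg (Cech alpha' k) / K} :=
  << cech_incl k t >>.
have pair_chain := @subdivide_chain_on K R _ _ _ pair_map_face s sS.
have pairsP l (t : Cech alpha l) : cech_modulus t ->
    supported (@small_pairs l) (subdivide pair_map s t).
  by move=> /subdivide_pairs_supported tP m /tP[].
have E l (a : {freeg (Cech alpha l) / K}) : fglift (@f l) a =
    fglift (psi1 (k := l)) (fglift (subdivide pair_map s (k := l)) a).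
  apply: (@eq_supported K _ _ setT (fglift (@f l))
    (fglift (psi1 (k := l)) \o fglift (subdivide pair_map s (k := l)))) =>
      //= t _.
  by rewrite !fglift1.
suff [e _ eE] : exists2 e : {freeg (Cech alpha' k.+1) / K}, supported setT e &
    free_bdry e = fglift (@g k) c - fglift (@f k) c.
  by exists e; rewrite eE E.
apply: (@carrier_homologous K _ _ cech_modulus cech_modulus_face_closed P) =>
  //.
- move=> l t tP; apply: full_simplex_acyclic; rewrite /points_fset.
  by have [tS [y ty]] := pointsP (cech_incl l t); exact: cech_imfset tS ty.
- move=> l i t tP m u uF j; have /imfsetP[j' _ ->] := uF j.
  by rewrite points_face tuple_faceE; apply/imfsetP; exists (lift i j').
- move=> l t tP; rewrite /f (bdry_lift psi1_chain (pairsP _ _ tP)).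
  by rewrite (pair_chain (fun=> setT))// -E.
- by apply: chain_on_cells => l i t tP; rewrite cell_funP.
- move=> t tP; rewrite /f (aug_lift psi1_aug (pairsP _ _ tP)).
  exact: (subdivide_aug_on pair_map s0 (A' := fun=> setT)).
- by move=> t tP; exact: augU.
- move=> l t tP.
  apply: (@supported_lift K _ _ _ _ _ _ (subdivide_pairs_supported tP)) =>
    m [mP mt].
  apply: (@supportedS _ _ _ _ _ _ (psi1_carried mP)) => u uF i.
  have /imfsetP[j _ ->] := uF i; have [j' ->] := mt j.
  by apply/imfsetP; exists j'.
- move=> l t tP; apply: supportedU => i.
  by apply/imfsetP; exists i.
Qed.

End SubdividedPairs.

Lemma realize_injective k (c : {freeg (Cech alpha k) / K}) (w : {freeg (Sing
  k.+1) / K}) :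
  free_bdry c = 0 -> free_bdry w = free_fun (realize alpha_alpha') c ->
  exists e : {freeg (Cech alpha' k.+1) / K}, free_bdry e = free_fun cech_incl c.
Proof.
move=> c0 wE.
have [psi1 [psi1_chain psi1_aug psi1_carried]] := second_chain_exists.
have [eta1 eta1_gt0 etaw] := common_modulus (dom w).
have [eta2 eta2_gt0 etac] : exists2 eta, 0 < eta &
    forall t, t \in dom c -> cech_modulus eta t.
  apply: uniform_seq => [t _|eta eta' t le [tM tP]]; last first.
    split=> p q pq; [apply: tM|apply: tP] => l; exact: lt_le_trans (pq l) le.
  have [eta eta0 etaP] := common_modulus [:: realize_fun t].
  have [eta' eta'0 eta'P] :=
    simplex_uniform_continuous (@bary_continuous _ _ k (points t)) delta_gt0.
  exists (Num.min eta eta'); first by rewrite lt_min eta0.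
  split=> p q pq.
    apply: (etaP (realize_fun t) (mem_head _ _)) => l.
    by apply: lt_le_trans (pq l) _; rewrite ge_min lexx.
  by apply: eta'P => l; apply: lt_le_trans (pq l) _; rewrite ge_min lexx orbT.
(* One scale for [w] and [c]: the feet of the subdivided [c] are to be the boundary of the
   subdivided [w], so both must use the same universal chain. *)
pose eta := Num.min eta1 eta2.
have eta0 : 0 < eta by rewrite lt_min eta1_gt0.
have wM : supported (@modulus eta k.+1) w.
  move=> t /etaw tM p q pq; apply: tM => l.
  by apply: lt_le_trans (pq l) _; rewrite ge_min lexx.
have cM : supported (@cech_modulus eta k) c.
  move=> t /etac[tM tP]; split=> p q pq; [apply: tM|apply: tP] => l;
    by apply: lt_le_trans (pq l) _; rewrite ge_min lexx orbT.
have [s [s0 s_small sS]] := subdivision_exists K eta0.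
pose y : chains k pairs := fglift (subdivide pair_map s (k := k)) c.
have pair_chain := @subdivide_chain_on K R _ _ _ pair_map_face s sS.
have y0 : free_bdry y = 0.
  exact: (@bdry_lift_cycle K _ _ (fun=> setT) _ k c (pair_chain _)).
have yP : supported (@small_pairs k) y.
  apply: (@supported_lift K _ _ _ _ _ _ cM) => t tP m.
  by move=> /(subdivide_pairs_supported s_small tP)[].
have [e1 e1E] := incl_homologous eta0 s0 s_small sS psi1_chain psi1_aug
  psi1_carried cM c0.
have [e2 e2E] := second_homologous psi1_chain psi1_aug psi1_carried yP y0.
pose u := subdivided_points s w.
have uR : supported (@rips k.+1) u by apply: subdivided_points_rips s_small _ _
  wM.
(* The foot of a point of an affine simplex is the value there of its realization, so both sides
   evaluate the realization of [c] on the same subdivision. *)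
have footE : free_fun (tuple_map foot) y = free_bdry u :> chains k 'rV[R]_n.
  rewrite /u (bdry_subdivided_points sS) [free_bdry w]wE /y /subdivided_points.
  apply: (@eq_supported K _ _ setT
    (@free_fun K _ _ (tuple_map foot) k \o fglift (subdivide pair_map s (k :=
      k)))
    (fglift (subdivide singular_points s (k := k)) \o
      @free_fun K _ _ (realize alpha_alpha') k)) => // t _ /=.
  rewrite [in RHS]/free_fun !fglift1 /subdivide.
  apply: (@eq_supported K _ _ setT
    (@free_fun K _ _ (tuple_map foot) k \o @free_fun K _ _ (pair_map t) k)
    (@free_fun K _ _ (singular_points (realize alpha_alpha' k t)) k)) =>
      // p _ /=.
  rewrite /free_fun !fglift1; congr << _ >>; apply/ffunP => i.
  by rewrite !tuple_mapE foot_pair_map.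
(* Since [u] bounds the feet, its image under [psi] bounds the sampled feet; [e2] and [e1] lead from
   these through [psi1] to the inclusion of [c]. *)
exists (e1 - e2 + free_fun cech_incl (fglift (psi (k := k.+1)) u)).
rewrite linearD linearB /= e1E e2E footE -/y.
rewrite -(free_funP cech_incl) (bdry_lift psi_chain uR).
by rewrite opprB addrA subrK subrK.
Qed.

End Injectivity.

End Sample.
End Comparison.

(** * The isomorphism on homology *)

(** The natural map goes from the image to the homology of [X], against the direction in which the
    isomorphism is stated. *)
Lemma lmod_iso_inv (K : fieldType) (U V : lmodType K) (g : {linear V -> U}) :
  injective g -> (forall u, exists v, g v = u) -> lmod_iso U V.
Proof.
move=> g_inj g_surj; pose f u := xget 0 [set v | g v = u].
have gf u : g (f u) = u.
  by have [v gv] := g_surj u; exact: (@xgetI _ 0 [set v | g v = u] v).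
have f_linear : linear f by move=> a u v; apply: g_inj; rewrite linearP !gf.
exists (HB.pack_for {linear U -> V} f (GRing.isLinear.Build K U V *:%R f
  f_linear)).
by exists g => [u|v] /=; [exact: gf|apply: g_inj; exact: gf].
Qed.

Lemma free_homology_map_eq0 (K : fieldType) (A B : semisimplicial)
    (f : semisimplicial_map A B) k (z : lin_ker (bdry (free_complex K A) k)) :
  homology_map (free_map K f) (coker_pi _ z) = 0 <->
  exists e : {freeg (B k.+1) / K}, free_bdry e = free_fun f (val z).
Proof.
rewrite homology_map_pi -(linear0 (coker_pi (@bdry_cycle K (free_complex K B)
  k))).
rewrite coker_pi_eq; split=> -[e eE]; exists e.
  by have := congr1 val eE; rewrite subr0.
by rewrite subr0; exact/val_inj.
Qed.

Theorem corollary11 (R : realType) (K : fieldType) (n : nat)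
    (X S : set 'rV[R]_n) (alpha alpha' : R)
    (X_neq0 : X !=set0) (X_compact : compact X)
    (X_reach : (0 < reach X)%E)
    (S_neq0 : S !=set0) (S_closed : closed S) (S_bounded : bounded_set S)
    (alpha_gt0 : 0 < alpha) (alpha_lt : alpha < alpha')
    (dH_lt : hausdorff_dist X S < Num.min alpha ((alpha' - alpha) / 2))
    (reach_gt : ((Num.max (4 * hausdorff_dist X S)
                    (alpha' + hausdorff_dist X S))%:E < reach X)%E)
    (k : nat) :
  lmod_iso (singular_homology R (set_type X) K k)
    (lin_im (incl_homology (cech_subset (S := S) (ltW alpha_lt)) K k)).
Proof.
have S_compact : compact S by exact: bounded_closed_compact.
pose eps := hausdorff_dist X S.
have near_S x : X x -> exists2 s, S s & eucl_dist x s <= eps.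
  exact: hausdorff_dist_l.
have near_X s : S s -> exists2 x, X x & eucl_dist s x <= eps.
  exact: hausdorff_dist_r.
have eps_ge0 : 0 <= eps.
  have [x Xx] := X_neq0; have [s _ xs] := near_S x Xx.
  exact: le_trans (eucl_dist_ge0 _ _) xs.
have lt_reach : ((alpha' + eps)%:E < reach X)%E.
  by apply: le_lt_trans reach_gt; rewrite lee_fin le_max lexx orbT.
move: dH_lt; rewrite -/eps lt_min => /andP[eps_lt_alpha eps_lt].
(* The largest value that satisfies both constraints of the comparison; the two bounds on the
   Hausdorff distance make the two terms positive. *)
pose delta := Num.min (alpha - eps) (alpha' - alpha - 2 * eps).
have delta_gt0 : 0 < delta by rewrite lt_min; apply/andP; split; lra.
have le_alpha : delta + eps <= alpha by rewrite -lerBrDr ge_min lexx.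
have le_alpha' : delta + alpha + 2 * eps <= alpha'.
  have : delta <= alpha' - alpha - 2 * eps by rewrite ge_min lexx orbT.
  by lra.
pose alpha_le := ltW alpha_lt.
have [psi [psi_chain psi_aug psi_carried]] :=
  sample_chain_exists K near_S le_alpha.
pose Phi := realize X_compact X_neq0 near_X lt_reach (lexx alpha').
pose Phi_incl := realize X_compact X_neq0 near_X lt_reach alpha_le.
pose iota := incl_homology (cech_subset (S := S) alpha_le) K k.
pose g : {linear lin_im iota -> singular_homology R (set_type X) K k} :=
  @homology_map K _ _ (free_map K Phi) k \o val.
have PhiE (c : {freeg (ordered_set (cech S alpha) k) / K}) :
    free_fun Phi (free_fun (cech_incl S alpha_le) c) = free_fun Phi_incl c.
  apply: (@eq_supported K _ _ setT (@free_fun K _ _ Phi k \o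
    @free_fun K _ _ (cech_incl S alpha_le) k) (@free_fun K _ _ Phi_incl k)) =>
      //= s _.
  by rewrite /free_fun !fglift1.
apply: (@lmod_iso_inv K _ _ g).
  (* An element of the kernel is the image of a class at scale [alpha], represented by [z]. By
     [PhiE], a chain that bounds its image in [X] bounds the realization of [z] at that scale, which
     is what [realize_injective] takes. *)
  apply: raddf_inj => v gv0; apply/val_inj.
  have /asboolP[h hE] := valP v.
  rewrite -hE -[h]coker_piK; set z := repr h.
  have z0 : free_bdry (val z) = 0 by exact/eqP/(valP z).
  apply/(@free_homology_map_eq0 K _ _ (cech_incl S alpha_le)).
  have /free_homology_map_eq0[w wE] : homology_map (free_map K Phi)
      (coker_pi _ (Defs.cycle_map (free_map K (cech_incl S alpha_le)) z)) = 0.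
    by rewrite -homology_map_pi coker_piK; move: gv0; rewrite /g /= -hE.
  rewrite /= PhiE in wE.
  exact: (realize_injective delta_gt0 eps_ge0 near_S le_alpha' psi_chain
    psi_aug psi_carried z0 wE).
move=> u; rewrite -[u]coker_piK; set z := repr u.
have z0 : free_bdry (val z) = 0 by exact/eqP/(valP z).
have [c c0 [e eE]] := realize_surjective X_compact X_neq0 delta_gt0 eps_ge0
  near_S near_X le_alpha
  le_alpha' lt_reach psi_chain psi_aug psi_carried alpha_le z0.
have c_cycle : (c : free_complex K (ordered_set (cech S alpha)) k) \in
    ker_pred (bdry (free_complex K (ordered_set (cech S alpha))) k).
  by rewrite inE; apply/eqP.
pose zc : lin_ker (bdry (free_complex K (ordered_set (cech S alpha))) k) :=
  LinKer c_cycle.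
have v_im : iota (coker_pi _ zc) \in im_pred iota by apply/asboolP;
  exists (coker_pi _ zc).
exists (LinIm v_im).
change (homology_map (free_map K Phi) (iota (coker_pi _ zc)) = coker_pi _ z).
rewrite [iota _]homology_map_pi homology_map_pi.
apply/esym/coker_pi_eq; exists e; apply/val_inj.
rewrite -PhiE in eE; exact: eE.
Qed.
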